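(* Let $N\ge2$ be an integer and let $[\beta_L,\beta_U]$ be an admissible interval generated by an admissible block $t_1t_2$ of length two. Then $\lceil (N-1)/2\rceil\le t_1\le N-1$, $\overline{t_1}\le t_2<t_1$, and for any $\beta\in[\beta_L,\beta_U]$ $$\dim_H\mathbf{U}_{\beta,N}=\frac{\log\Big(2t_1+1-N+\sqrt{(2t_1+1-N)^2+4(2t_2+2-N)}\Big)-\log2}{\log\beta}.$$
   Context: Fix the integer $N$. Blocks of equal length and infinite sequences over $\{0,1,\dots,N-1\}$ are compared lexicographically. For a digit $c$, $\overline{c}:=N-1-c$, and $\overline{c_1c_2\cdots}:=\overline{c_1}\,\overline{c_2}\cdots$ for blocks and sequences. For a block with $c_p<N-1$, $c_1\cdots c_p^+:=c_1\cdots c_{p-1}(c_p+1)$. $(c_1\cdots c_p)^\infty$ is the periodic sequence repeating the block. For $\beta>1$, a $\beta$-expansion of $x$ is a sequence $(d_i)\in\{0,\dots,N-1\}^\infty$ with $x=\sum_{i\ge1}d_i\beta^{-i}$; $\mathbf{U}_{\beta,N}$ is the set of real $x$ having exactly one $\beta$-expansion. Quasi-greedy expansion: for $\beta\in(1,N]$, $(\alpha_i(\beta))_{i\ge1}$ is the quasi-greedy $\beta$-expansion of $1$: $\alpha_n(\beta)$ is recursively the largest element of $\{0,\dots,N-1\}$ with $\sum_{i=1}^{n}\alpha_i(\beta)\beta^{-i}<1$. Admissible block: $t_1\cdots t_p\in\{0,\dots,N-1\}^p$ is admissible if $t_p<N-1$ and for every $1\le i\le p$: $\overline{t_1\cdots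 t_p}\le t_i\cdots t_pt_1\cdots t_{i-1}$ and $t_i\cdots t_p^+\,\overline{t_1\cdots t_{i-1}}\le t_1\cdots t_p^+$. Generalized Thue-Morse sequence: $(\theta_i)=(\theta_i(t_1\cdots t_p^+))$ is defined by $\theta_1\cdots\theta_p=t_1\cdots t_p^+$ and, for $m\ge0$, $\theta_{2^mp+1}\cdots\theta_{2^{m+1}p}=\overline{\theta_1\cdots\theta_{2^mp}}\,^+$. Admissible interval: $[\beta_L,\beta_U]$ is the admissible interval generated by an admissible block $t_1\cdots t_p$ if $\beta_L,\beta_U\in(1,N]$ satisfy $(\alpha_i(\beta_L))=(t_1\cdots t_p)^\infty$ and $(\alpha_i(\beta_U))=(\theta_i(t_1\cdots t_p^+))$. *)

(* Defs.v *)
(* Written with MathComp and MathComp-Analysis. *)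
From HB Require Import structures.
From mathcomp Require Import all_boot all_order all_algebra.
From mathcomp Require Import all_classical all_reals all_analysis.
Import Order.TTheory GRing.Theory Num.Theory.
Import numFieldNormedType.Exports.

Set Implicit Arguments.
Unset Strict Implicit.
Unset Printing Implicit Defensive.

Local Open Scope classical_set_scope.
Local Open Scope ring_scope.

(* Digits are natural numbers less than N, blocks have type [seq nat] and
   infinite sequences type [nat -> nat]. Positions start at 0, so the i-th term
   (i >= 1) of a block or sequence sits at position i - 1, and the digit at
   position i carries the weight beta^-(i+1). *)

Section blocks.
Local Open Scope nat_scope.

Definition compl_digit (N c : nat) : nat := N.-1 - c.

Definition compl_block (N : nat) (s : seq nat) : seq nat :=
  map (compl_digit N) s.

(* c_1...c_p^+; only meaningful for nonempty blocks *)
Definition incr_last (s : seq nat) : seq nat := incr_nth s (size s).-1.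

(* lexicographic order on blocks *)
Definition block_le (s t : seq nat) : bool :=
  ((s : seqlexi nat) <= (t : seqlexi nat))%O.

(* With i counted from 0, [rot i t] is t_{i+1}...t_p t_1...t_i. *)
Definition admissible (N : nat) (t : seq nat) : Prop :=
  [/\ 0 < size t, all (fun c => c < N) t, last 0 t < N.-1 &
      forall i, i < size t ->
        block_le (compl_block N t) (rot i t) /\
        block_le (drop i (incr_last t) ++ compl_block N (take i t))
                 (incr_last t)].

Definition periodic_seq (t : seq nat) (i : nat) : nat := nth 0 t (i %% size t).

(* theta_1...theta_{2^m p}, starting from s = t_1...t_p^+ *)
Fixpoint thue_morse_block (N : nat) (s : seq nat) (m : nat) : seq nat :=
  if m is m'.+1 then
    let b := thue_morse_block N s m' in b ++ incr_last (compl_block N b)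
  else s.

(* Each block is a prefix of the next one and the m-th has length
   2^m * size s, which exceeds m when s is nonempty. *)
Definition thue_morse (N : nat) (s : seq nat) (i : nat) : nat :=
  nth 0 (thue_morse_block N s i) i.

End blocks.

Section expansions.
Context {R : realType}.

Definition block_value (beta : R) (s : seq nat) : R :=
  \sum_(i < size s) (nth 0%N s i)%:R * beta ^- i.+1.

(* The maximum ranges over a nonempty set: the digit 0 always qualifies. *)
Fixpoint quasi_greedy_block (N : nat) (beta : R) (n : nat) : seq nat :=
  if n is n'.+1 then
    let s := quasi_greedy_block N beta n' in
    rcons s (\max_(c < N | (block_value beta (rcons s c) < 1)%R) c)%N
  else [::].

Definition quasi_greedy (N : nat) (beta : R) (i : nat) : nat :=
  nth 0%N (quasi_greedy_block N beta i.+1) i.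

Definition is_expansion (N : nat) (beta x : R) (d : nat -> nat) : Prop :=
  (forall i, (d i < N)%N) /\
  series (fun i => (d i)%:R * beta ^- i.+1) @ \oo --> x.

Definition univoque_set (N : nat) (beta : R) : set R :=
  [set x | exists! d : nat -> nat, is_expansion N beta x d].

Definition admissible_interval (N : nat) (t : seq nat) (betaL betaU : R)
    : Prop :=
  [/\ admissible N t,
      1 < betaL <= N%:R,
      1 < betaU <= N%:R,
      quasi_greedy N betaL =1 periodic_seq t &
      quasi_greedy N betaU =1 thue_morse N (incr_last t)].

End expansions.

Section hausdorff.
Context {R : realType}.
Local Open Scope ereal_scope.

Definition diameter (A : set R) : \bar R :=
  ereal_sup [set z | exists x y, [/\ A x, A y & z = `|x - y|%:E]].

(* The empty set gets weight 0 for every s, including s = 0. *)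
Definition diameter_pow (s : R) (A : set R) : \bar R :=
  if A == set0 then 0 else poweR (diameter A) s.

Definition hausdorff_content (s delta : R) (A : set R) : \bar R :=
  ereal_inf [set z | exists F : (set R)^nat,
    [/\ A `<=` \bigcup_k F k,
        forall k, diameter (F k) <= delta%:E &
        z = \sum_(0 <= k <oo) diameter_pow s (F k)]].

Definition hausdorff_measure (s : R) (A : set R) : \bar R :=
  ereal_sup [set hausdorff_content s delta A |
             delta in [set delta : R | (0 < delta)%R]].

Definition hausdorff_dim (A : set R) : \bar R :=
  ereal_inf [set s%:E | s in [set s : R | (0 <= s)%R /\
                                          hausdorff_measure s A = 0]].

End hausdorff.

(* Main.v *)
Require Import Defs.
From mathcomp Require Import all_boot all_order all_algebra.
From mathcomp Require Import all_classical all_reals all_analysis.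
From mathcomp Require Import zify ring lra.
Import Order.TTheory GRing.Theory Num.Theory.
Import numFieldNormedType.Exports.

(** Write c = N - 1 - t1, and let V be the set of digit sequences all of whose
    tails, and all tails of whose mirror images (every digit d replaced by
    N - 1 - d), are lexicographically at most theta = theta(t1 (t2 + 1)), the
    quasi-greedy expansion at betaU. Let X be the smaller set of sequences over
    c, ..., t1 in which t1 is followed by at most t2 and c by at least
    N - 1 - t2. Let beta be a base of the interval. The expansions of univoque
    points, apart from the two constant ones 00... and (N - 1)(N - 1)..., end up
    in V once an initial run of one extreme digit and one further digit are
    removed; and every sequence of X is such an expansion, apart from countably
    many. So it is enough to count prefixes: X and V have, up to subexponential
    factors, rho ^ n prefixes of length n, where rho is the larger root of

      rho ^ 2 = (t1 - c) rho + (2 t2 + 2 - N);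

    a cylinder of length n has diameter of order beta ^ - n, and the dimension
    is ln rho / ln beta. The quadratic is the characteristic polynomial of X:
    reflection exchanges the two extreme digits c and t1, each of which is
    followed by the other or by one of t2 - c middle digits, whereas the
    t1 - c - 1 middle digits may be followed by anything.

    Upper bound. If a digit of a unique expansion is not maximal, the values of
    all later tails are smaller than 1 ([unique_code_tail_lt1]), since otherwise
    that digit could be increased; by the maximality in the definition of
    quasi-greedy expansions those tails are then at most theta
    ([lexle_of_val_lt1]). A sequence of V leaves X only by containing
    t1 (t2 + 1) or its mirror image. From there on it is almost determined: if
    it starts with the first L = 2 ^ m * 2 terms of theta, then the next L terms
    are the mirror image of these, or that block with its last digit increased
    ([theta_prefixed_step]). In the first case the situation repeats, reflected,
    and in the second the sequence starts with the first 2 L terms of theta.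
    This leaves only subexponentially many continuations
    ([pcover_theta_prefixed]), hence at most C * tau ^ n prefixes for every
    tau > rho ([pcover_lex_bounded], [pcover_codes]), and cylinders
    give covers which make the Hausdorff measure vanish
    ([univoque_measure_eq0]).

    Lower bound, for rho > 1. Instead of a measure on X, a map from an interval
    to X is used. A nonnegative eigenvector of the transition matrix of X
    cuts an interval into pieces indexed by the first digit, each of these by
    the second digit, and so on, all pieces of generation n having length at
    most of order rho ^ - n ([exists_coding]). Two sequences of X that first
    differ at position n have values at distance at least beta ^ - (n + 3)
    ([inner_separation]), because tails of X have value at most 1. So the
    parameter in the interval is a Hoelder function, with exponent
    ln rho / ln beta, of the point it codes, and the sigma-subadditivity of the
    Lebesgue measure on the interval bounds the Hausdorff measure from below
    ([hausdorff_measure_gt0_of_holder]). *)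

Set Implicit Arguments.
Unset Strict Implicit.
Unset Printing Implicit Defensive.

Local Open Scope classical_set_scope.
Local Open Scope ring_scope.

(** * Hausdorff measure: zero from covers, positive from Hoelder maps *)
Section hausdorff_bounds.
Context {R : realType}.
Implicit Types (A F : set R) (s : R).

Lemma diameter_dist A x y : A x -> A y -> (`|x - y|%:E <= diameter A)%E.
Proof. by move=> Ax Ay; apply: ereal_sup_ubound; exists x, y. Qed.

Lemma diameter_le A (r : R) :
  (forall x y, A x -> A y -> `|x - y| <= r) -> (diameter A <= r%:E)%E.
Proof.
by move=> H; apply: ge_ereal_sup => _ [x [y [Ax Ay ->]]]; rewrite lee_fin; apply: H.
Qed.

Lemma diameter_ge0 A : A !=set0 -> (0 <= diameter A)%E.
Proof. by move=> [x Ax]; have := diameter_dist Ax Ax; rewrite subrr normr0. Qed.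

Lemma diameter_pow_ge0 s A : (0 <= diameter_pow s A)%E.
Proof. by rewrite /diameter_pow; case: ifP => // _; exact: poweR_ge0. Qed.

Lemma diameter_pow_le s A (r : R) : 0 <= s -> 0 <= r ->
  (diameter A <= r%:E)%E -> (diameter_pow s A <= (r `^ s)%:E)%E.
Proof.
move=> s0 r0 Ar; rewrite /diameter_pow; case: ifPn => [_|A0].
  by rewrite lee_fin powR_ge0.
have dA0 : (0 <= diameter A)%E by apply: diameter_ge0; exact/set0P.
by rewrite -poweR_EFin; apply: gt0_ler_poweR; rewrite // in_itv/= leey andbT.
Qed.

Lemma hausdorff_content_ge0 s (delta : R) A : (0 <= hausdorff_content s delta A)%E.
Proof.
apply: le_ereal_inf_tmp => _ [F [_ _ ->]].
by apply: nneseries_ge0 => k _ _; exact: diameter_pow_ge0.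
Qed.

(** Finite covers suffice, and an upper bound [r] for all their diameters can
    take the place of the diameters themselves; both hold for covers by
    cylinders. *)
Lemma hausdorff_measure_eq0 s A : 0 <= s ->
  (forall eps : R, 0 < eps -> exists (l : seq (set R)) (r : R),
    [/\ 0 <= r <= eps, forall x, A x -> exists i, nth set0 l i x,
        forall i, (diameter (nth set0 l i) <= r%:E)%E &
        (size l)%:R * r `^ s <= eps]) ->
  hausdorff_measure s A = 0%E.
Proof.
move=> s0 H; apply/eqP; rewrite eq_le; apply/andP; split; last first.
  apply: le_trans (hausdorff_content_ge0 s 1 A) _.
  by apply: ereal_sup_ubound; exists 1 => //=; exact: ltr01.
apply: ge_ereal_sup => _ [delta /= delta0 <-].
apply/lee_addgt0Pr => eps eps0; rewrite add0e.
have [|l [r [/andP[r0 re] cov dl sz]]] := H (Num.min delta eps).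
  by rewrite lt_min delta0.
move: re sz; rewrite !le_min => /andP[rd _] /andP[_ sz].
apply: (@le_trans _ _ (\sum_(0 <= k <oo) diameter_pow s (nth set0 l k))%E).
  apply: ereal_inf_lbound; exists (nth set0 l); split => //.
    by move=> x /cov[i ix]; exists i.
  by move=> k; apply: le_trans (dl k) _; rewrite lee_fin.
rewrite (nneseries_split 0 (size l)); last by move=> k _; exact: diameter_pow_ge0.
rewrite [X in (_ + X)%E]eseries0 ?adde0 ?add0n; last first.
  by move=> k /= kl _; rewrite nth_default// /diameter_pow eqxx.
apply: (@le_trans _ _ (\sum_(0 <= k < size l) (r `^ s)%:E)%E).
  by apply: lee_sum => k _; exact: diameter_pow_le.
by rewrite sumEFin lee_fin big_mkord sumr_const card_ord -mulr_natl.
Qed.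

(** The mass distribution principle in a form that needs no measure on [A]:
    a cover of [A] by sets [F k] pulls back to a cover of the parameters by sets
    of length at most [2 * C] times the [s]-th powers of the diameters of the
    [F k], so that these powers cannot have a small sum. The countable
    exceptional set has Lebesgue measure 0. *)
Lemma hausdorff_measure_gt0_of_holder s A (u C : R) (E : set R) (phi : R -> R) :
  0 <= s -> 0 < u -> 0 < C -> countable E ->
  (forall y, 0 <= y < u -> ~ E y -> A (phi y)) ->
  (forall y y', 0 <= y < u -> 0 <= y' < u ->
     `|y - y'| <= C * `|phi y - phi y'| `^ s) ->
  (0 < hausdorff_measure s A)%E.
Proof.
move=> s0 u0 C0 Ecnt phiA phiH.
have b0 : 0 < u / (2 * C) by rewrite divr_gt0// mulr_gt0.
apply: (@lt_le_trans _ _ (u / (2 * C))%:E); first by rewrite lte_fin.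
apply: (@le_trans _ _ (hausdorff_content s 1 A)); last first.
  by apply: ereal_sup_ubound; exists 1 => //=; exact: ltr01.
apply: le_ereal_inf_tmp => _ [F [AF F1 ->]].
pose Y k := [set y | [/\ 0 <= y < u, ~ E y & F k (phi y)]].
have [J HJ] : exists J : nat -> set R, forall k,
    [/\ measurable (J k), Y k `<=` J k &
        (lebesgue_measure (J k) <= (2 * C)%:E * diameter_pow s (F k))%E].
  suff H k : exists J : set R, [/\ measurable J, Y k `<=` J &
        (lebesgue_measure J <= (2 * C)%:E * diameter_pow s (F k))%E].
    by have [J HJ] := choice H; exists J.
  (* [Y k] may fail to be measurable, so it is enclosed in an interval around
     one of its points; this costs the factor 2. *)
  have [[y0 [y0u Ey0 Fy0]]|NY] := pselect (Y k !=set0); last first.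
    exists set0; split => //; first by move=> y Yy; case: NY; exists y.
    by rewrite measure0 mule_ge0 ?diameter_pow_ge0// lee_fin mulr_ge0// ltW.
  have Fk0 : F k !=set0 by exists (phi y0).
  have Dfin : diameter (F k) \is a fin_num.
    rewrite ge0_fin_numE ?diameter_ge0//.
    by apply: le_lt_trans (F1 k) _; rewrite ltry.
  pose D := fine (diameter (F k)).
  have D0 : 0 <= D by rewrite fine_ge0// diameter_ge0.
  have -> : diameter_pow s (F k) = (D `^ s)%:E.
    rewrite /diameter_pow ifF; last exact/negbTE/set0P.
    by rewrite -[diameter _]fineK.
  have P0 : 0 <= D `^ s by exact: powR_ge0.
  exists [set` `[y0 - C * D `^ s, y0 + C * D `^ s]]; split.
  - exact: measurable_itv.
  - move=> y [yu _ Fy] /=; rewrite in_itv/=.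
    suff : `|y - y0| <= C * D `^ s by rewrite ler_norml; lra.
    apply: le_trans (phiH _ _ yu y0u) _; rewrite ler_pM2l//.
    apply: ge0_ler_powR => //; rewrite ?nnegrE//.
    by rewrite -lee_fin /D fineK// diameter_dist.
  - rewrite lebesgue_measure_itv /= lte_fin; case: ifP => _.
      by rewrite -EFinB -EFinM lee_fin; lra.
    by rewrite -EFinM lee_fin mulr_ge0// mulr_ge0// ltW.
have mE : measurable E by exact: countable_measurable.
pose G k := if k is k'.+1 then J k' else E.
have mG k : measurable (G k) by case: k => //= k; case: (HJ k).
have cov : [set` `[0, u[] `<=` \bigcup_k G k.
  move=> y /=; rewrite in_itv/= => yu.
  have [Ey|NEy] := pselect (E y); first by exists 0%N.
  have [k _ Fk] := AF _ (phiA _ yu NEy).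
  by exists k.+1 => //=; case: (HJ k) => _ YJ _; apply: YJ.
have : (lebesgue_measure ([set` `[0%R, u[] : set R)
        <= \sum_(0 <= k <oo) lebesgue_measure (G k))%E.
  by apply: measure_sigma_subadditive => //; exact: measurable_itv.
rewrite lebesgue_measure_itv /= lte_fin u0 sube0.
rewrite nneseries_recl//= countable_lebesgue_measure0// add0e => uG.
have : (u%:E <= \sum_(0 <= k <oo) (2 * C)%:E * diameter_pow s (F k))%E.
  apply: le_trans uG _.
  rewrite -(nneseries_addn (f := fun k => lebesgue_measure (G k)) 1)//.
  by apply: lee_nneseries => [//|k _]; rewrite addn1; case: (HJ k).
rewrite nneseriesZl; last by move=> k _; exact: diameter_pow_ge0.
have C2 : 0 < 2 * C by rewrite mulr_gt0.
by rewrite -lee_pdivrMl// -EFinM mulrC.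
Qed.

End hausdorff_bounds.

(** * Values of digit sequences *)
(** Dependent choice along an invariant [P]; both the greedy expansion of a
    number and the coding of an interval arise as such orbits of pairs
    (digit, remainder). *)
Lemma orbit_exists (T : Type) (P : T -> Prop) (Q : T -> T -> Prop) :
  (forall x, P x -> exists y, P y /\ Q x y) ->
  forall x0, P x0 ->
  exists f : nat -> T, f 0%N = x0 /\ forall n, P (f n) /\ Q (f n) (f n.+1).
Proof.
move=> H x0 Px0.
have step x : exists y, P x -> P y /\ Q x y.
  by have [/H[y ?]|nPx] := pselect (P x); [exists y | exists x].
have [g Hg] := choice step.
exists (fun n => iter n g x0); split=> // n.
suff Pn : P (iter n g x0) by split=> //; case: (Hg _ Pn).
by elim: n => //= n /Hg[].
Qed.

Lemma natr_pred (R : pzRingType) n : (0 < n)%N -> n.-1%:R = n%:R - 1 :> R.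
Proof. by case: n => // n _; rewrite -[in RHS]natr1 addrK. Qed.

Section digit_sequences.
Variable N : nat.
Implicit Types (d e : nat -> nat).

Definition digits d := forall i, (d i < N)%N.
Definition tail (k : nat) d : nat -> nat := fun i => d (k + i)%N.
Definition mirror d : nat -> nat := fun i => compl_digit N (d i).

Lemma tail_mirror k d : tail k (mirror d) = mirror (tail k d).
Proof. by []. Qed.

Lemma tail_digits k d : digits d -> digits (tail k d).
Proof. by move=> D i; exact: D. Qed.

Lemma tail_tail k l d : tail k (tail l d) = tail (l + k) d.
Proof. by apply/funext => i; rewrite /tail addnA. Qed.

Lemma mirror_digits d : digits d -> digits (mirror d).
Proof. by move=> D i; have := D i; rewrite /mirror /compl_digit; lia. Qed.

Lemma mirrorK d : digits d -> mirror (mirror d) = d.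
Proof.
by move=> D; apply/funext => i; have := D i; rewrite /mirror /compl_digit; lia.
Qed.

End digit_sequences.

Section values.
Context {R : realType}.
Variables (N : nat) (b : R).
Hypothesis b1 : 1 < b.
Implicit Types (d e : nat -> nat).

Local Notation digits := (digits N).
Local Notation mirror := (mirror N).

Definition psum d n : R := series (fun i => (d i)%:R * b ^- i.+1) n.
Definition seqval d : R := limn (psum d).

Let b0 : 0 < b. Proof. exact: lt_trans b1. Qed.

Lemma psum0 d : psum d 0 = 0. Proof. by rewrite /psum /series /= big_geq. Qed.

Lemma psumSr d n : psum d n.+1 = psum d n + (d n)%:R * b ^- n.+1.
Proof. by rewrite /psum /series /= big_nat_recr. Qed.

Lemma psumS d n : psum d n.+1 = ((d 0%N)%:R + psum (tail 1 d) n) / b.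
Proof.
rewrite /psum /series /= big_nat_recl//= expr1 mulrDl; congr (_ + _).
rewrite mulr_suml; apply: eq_bigr => i _.
by rewrite /tail add1n -mulrA -invfM -exprSr.
Qed.

Lemma psum_ge0 d n : 0 <= psum d n.
Proof.
by apply: sumr_ge0 => i _; rewrite mulr_ge0// invr_ge0 exprn_ge0// ltW.
Qed.

Lemma psum_nd d : {homo psum d : m n / (m <= n)%N >-> m <= n}.
Proof.
apply/nondecreasing_seqP => n; rewrite psumSr lerDl.
by rewrite mulr_ge0// invr_ge0 exprn_ge0// ltW.
Qed.

(** The value of the constant sequence N - 1, which is the largest of all. *)
Definition vmax : R := (N%:R - 1) / (b - 1).

Lemma psum_mirror d n : digits d ->
  psum d n + psum (mirror d) n = vmax * (1 - b ^- n).
Proof.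
move=> D; elim: n d D => [|n IH] d D.
  by rewrite !psum0 expr0 invr1 subrr mulr0 addr0.
have := IH _ (tail_digits 1 D); rewrite !psumS tail_mirror => {}IH.
rewrite -mulrDl addrACA IH /mirror /compl_digit -natrD.
have -> : (d 0%N + (N.-1 - d 0%N) = N.-1)%N by have := D 0%N; lia.
have -> : (N.-1)%:R = N%:R - 1 :> R.
  by apply: natr_pred; have := D 0%N; lia.
rewrite /vmax exprS invfM; have := b1; have := b0 => *.
set z := b ^- n; field.
by rewrite gt_eqF//= gt_eqF// subr_gt0.
Qed.

Lemma psum_le d n : digits d -> psum d n <= vmax.
Proof.
move=> D; have P := psum_ge0 (mirror d) n.
have N1 : 1 <= N%:R :> R by rewrite ler1n; have := D 0%N; lia.
have V0 : 0 <= vmax by rewrite divr_ge0// subr_ge0// ltW.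
have : vmax * (1 - b ^- n) <= vmax.
  rewrite -[leRHS]mulr1 ler_wpM2l// gerBl invr_ge0 exprn_ge0//; exact: ltW.
by rewrite -(psum_mirror n D); lra.
Qed.

Lemma psum_cvg d : digits d -> psum d @ \oo --> seqval d.
Proof.
move=> D; apply: nondecreasing_is_cvgn; first exact: psum_nd.
by exists vmax => _ [n _ <-]; exact: psum_le.
Qed.

Lemma is_expansion_val d : digits d -> is_expansion N b (seqval d) d.
Proof. by move=> D; split => //; exact: psum_cvg. Qed.

Lemma expansion_val x d : is_expansion N b x d -> seqval d = x.
Proof. by move=> [D /cvg_lim]; apply. Qed.

Lemma seqval_ge d n : digits d -> psum d n <= seqval d.
Proof.
move=> D; apply: nondecreasing_cvgn_le; first exact: psum_nd.
by apply/cvg_ex; exists (seqval d); exact: psum_cvg.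
Qed.

Lemma seqval_le d x : digits d -> (forall n, psum d n <= x) -> seqval d <= x.
Proof.
move=> D H; apply: limr_le; first by apply/cvg_ex; exists (seqval d); exact: psum_cvg.
by apply: nearW.
Qed.

Lemma seqval_ge0 d : digits d -> 0 <= seqval d.
Proof. by move=> D; rewrite -(psum0 d); exact: seqval_ge. Qed.

Lemma seqval_lemax d : digits d -> seqval d <= vmax.
Proof. by move=> D; apply: seqval_le => // n; exact: psum_le. Qed.

Lemma seqvalS d : digits d -> seqval d = ((d 0%N)%:R + seqval (tail 1 d)) / b.
Proof.
move=> D; have D1 := tail_digits 1 D.
apply/eqP; rewrite eq_le; apply/andP; split.
  apply: seqval_le => // -[|n]; 
    first by rewrite psum0 mulr_ge0 ?addr_ge0 ?seqval_ge0 ?invr_ge0 ?(ltW b0).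
  by rewrite psumS ler_pM2r ?invr_gt0// lerD2l seqval_ge.
rewrite ler_pdivrMr// -lerBrDl; apply: seqval_le => // n.
by rewrite lerBrDl -ler_pdivrMr// -psumS seqval_ge.
Qed.

Lemma seqval_split d n : digits d -> seqval d = psum d n + b ^- n * seqval (tail n d).
Proof.
move=> D; elim: n => [|n IH]; first by rewrite psum0 expr0 invr1 mul1r add0r.
rewrite IH psumSr (seqvalS (tail_digits n D)) tail_tail addn1 /tail addn0.
rewrite exprS invfM; have := gt_eqF b0 => /negbT ?.
by field; rewrite expf_neq0.
Qed.

Lemma expn_cvg0 : (fun n => b ^- n) @ \oo --> (0 : R).
Proof.
rewrite (_ : (fun n => _) = (fun n => b^-1 ^+ n)); last first.
  by apply/funext => n; rewrite exprVn.
by apply: cvg_expr; rewrite ger0_norm ?invf_lt1// invr_ge0 ltW.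
Qed.

Lemma expn_le_eq0 (x K : R) : (forall n, `|x| <= K * b ^- n) -> x = 0.
Proof.
move=> H; apply/eqP; rewrite -normr_le0.
have cK : (fun n => K * b ^- n) @ \oo --> (0 : R).
  by rewrite -[X in _ --> X](mulr0 K); apply: cvgMl_tmp; exact: expn_cvg0.
rewrite -(cvg_lim _ cK)//; apply: limr_ge; first by apply/cvg_ex; exists 0.
by apply: nearW.
Qed.

(** An expansion algorithm whose remainders stay bounded expands its input. *)
Lemma seqval_unique d x (r : nat -> R) (M : R) : digits d ->
  (forall n, x = psum d n + b ^- n * r n) -> (forall n, `|r n| <= M) -> seqval d = x.
Proof.
move=> D H rM; apply/eqP; rewrite -subr_eq0; apply/eqP.
apply: (@expn_le_eq0 _ (vmax + M)) => n.
rewrite (H n) (seqval_split n D) opprD addrACA subrr add0r -mulrBr mulrC normrM.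
rewrite (@ger0_norm _ (b ^- n)); last by rewrite invr_ge0 exprn_ge0 ?ltW.
rewrite ler_wpM2r ?invr_ge0 ?exprn_ge0 ?(ltW b0)//.
apply: le_trans (ler_normB _ _) _; apply: lerD => //.
have Dn := tail_digits n D.
by rewrite ger0_norm ?seqval_ge0// seqval_lemax.
Qed.

Lemma seqval_mirror d : digits d -> seqval (mirror d) = vmax - seqval d.
Proof.
move=> D; apply: (seqval_unique (r := fun n => vmax - seqval (tail n d)) (M := vmax)).
- exact: mirror_digits.
- move=> n; have E := psum_mirror n D; rewrite (seqval_split n D).
  have -> : psum (mirror d) n = vmax * (1 - b ^- n) - psum d n by rewrite -E; ring.
  ring.
- move=> n; have Dn := tail_digits n D.
  by have := seqval_ge0 Dn; have := seqval_lemax Dn; rewrite ler_norml; lra.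
Qed.

(** Multiplying the remainder by [b] and subtracting a digit keeps it in
    [0, vmax]: as [b <= N], that interval has length at least 1, so either the
    integer part is a suitable digit, or the digit N - 1 is. *)
Lemma exists_expansion x : b <= N%:R -> 0 <= x <= vmax ->
  exists2 d, digits d & seqval d = x.
Proof.
move=> bN x0v.
have N1 : 1 <= N%:R :> R by apply: le_trans bN; exact: ltW.
have vE : b * vmax = vmax + (N%:R - 1).
  by rewrite /vmax; field; rewrite gt_eqF// subr_gt0.
have v1 : 1 <= vmax by rewrite ler_pdivlMr ?subr_gt0// mul1r lerD2r.
have step (y : nat * R) : 0 <= y.2 <= vmax -> exists y' : nat * R,
    0 <= y'.2 <= vmax /\ ((y'.1 < N)%N /\ b * y.2 = y'.1%:R + y'.2).
  case: y => _ r /= /andP[r0 rv].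
  have br0 : 0 <= b * r by rewrite mulr_ge0// ltW.
  have brv : b * r <= b * vmax by rewrite ler_pM2l.
  have [brN|brN] := ltP (b * r) (N%:R - 1).
    have /andP[t1 t2] := truncn_itv br0; set t := Num.truncn _ in t1 t2.
    exists (t, b * r - t%:R) => /=; rewrite -natr1 in t2; split; first lra.
    split; last by rewrite addrC subrK.
    by rewrite -(ltr_nat R); lra.
  exists (N.-1, b * r - (N%:R - 1)) => /=.
  have N0 : (0 < N)%N by rewrite -(ltr_nat R); lra.
  split; first by rewrite vE in brv; lra.
  by split; [rewrite prednK | rewrite -subn1 natrB//; lra].
have [f [f0 fS]] := orbit_exists step (x0 := (0%N, x)) x0v.
pose d n := (f n.+1).1.
have D : digits d by move=> n; case: (fS n) => _ [].
exists d => //; apply: (seqval_unique (r := fun n => (f n).2) (M := vmax)) => // n.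
  elim: n => [|n IH]; first by rewrite psum0 f0 expr0 invr1 mul1r add0r.
  rewrite psumSr -addrA {1}IH; congr (_ + _); have [_ [_ E]] := fS n.
  have -> : (f n).2 = ((d n)%:R + (f n.+1).2) / b.
    by rewrite /d -E mulrAC divff ?mul1r// gt_eqF.
  by rewrite exprS invfM; set z := b ^- n; ring.
by have [/andP[H1 H2] _] := fS n; rewrite ger0_norm.
Qed.

End values.

(** * Quasi-greedy expansions and unique codes *)
Section quasi_greedy_facts.
Context {R : realType}.
Variables (N : nat) (b : R).
Hypotheses (b1 : 1 < b) (N0 : (0 < N)%N).
Let q := quasi_greedy N b.

Lemma block_value_rcons (s : seq nat) c :
  block_value b (rcons s c) = block_value b s + c%:R * b ^- (size s).+1.
Proof.
rewrite /block_value.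
rewrite -(big_mkord xpredT (fun i => (nth 0%N (rcons s c) i)%:R * b ^- i.+1)).
rewrite size_rcons big_nat_recr//= big_mkord; congr (_ + _).
  by apply: eq_bigr => i _; rewrite nth_rcons ltn_ord.
by rewrite nth_rcons ltnn eqxx.
Qed.

Lemma size_quasi_greedy_block n : size (quasi_greedy_block N b n) = n.
Proof. by elim: n => //= n IH; rewrite size_rcons IH. Qed.

Lemma quasi_greedyE n :
  q n = (\max_(c < N |
    (block_value b (rcons (quasi_greedy_block N b n) c) < 1)%R) c)%N.
Proof. by rewrite /q /quasi_greedy /= nth_rcons size_quasi_greedy_block ltnn eqxx. Qed.

Lemma block_value_quasi_greedy n :
  block_value b (quasi_greedy_block N b n) = psum b q n.
Proof.
elim: n => [|n IH]; first by rewrite psum0 /block_value big_ord0.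
by rewrite psumSr quasi_greedyE /= block_value_rcons IH size_quasi_greedy_block.
Qed.

Lemma quasi_greedy_psum_lt1 n : psum b q n < 1.
Proof.
elim: n => [|n IH]; first by rewrite psum0.
rewrite psumSr quasi_greedyE.
set P := fun c : 'I_N => block_value b (rcons (quasi_greedy_block N b n) c) < 1.
have [|c Pc ->] := @eq_bigmax_cond _ P (fun c : 'I_N => c : nat).
  apply/card_gt0P; exists (Ordinal N0); rewrite -topredE /= /P block_value_rcons /=.
  by rewrite mul0r addr0 block_value_quasi_greedy.
move: Pc; rewrite -topredE /= /P block_value_rcons block_value_quasi_greedy.
by rewrite size_quasi_greedy_block.
Qed.

Lemma quasi_greedy_max n c : (c < N)%N -> (q n < c)%N ->
  1 <= psum b q n + c%:R * b ^- n.+1.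
Proof.
move=> cN; rewrite quasi_greedyE => qc; rewrite leNgt; apply/negP => H.
suff : (c <= \max_(c < N |
    (block_value b (rcons (quasi_greedy_block N b n) c) < 1)%R) c)%N.
  by rewrite leqNgt qc.
apply: (leq_bigmax_cond (Ordinal cN) (F := fun c : 'I_N => c : nat)).
by rewrite /= block_value_rcons size_quasi_greedy_block block_value_quasi_greedy.
Qed.

End quasi_greedy_facts.

(** The lexicographic order on sequences, in a form that can be used one digit
    at a time. *)
Definition lexle (d e : nat -> nat) :=
  forall j, (forall i, (i < j)%N -> d i = e i) -> (d j <= e j)%N.

Section unique_lex.
Context {R : realType}.
Variables (N : nat) (b : R).
Hypotheses (b1 : 1 < b) (bN : b <= N%:R).
Implicit Types d e : nat -> nat.

(** The property of [d] that makes its value univoque, stated on codes since it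
    passes to tails and mirror images. *)
Definition unique_code d := forall e, digits N e -> seqval b e = seqval b d -> e = d.

Let b0 : 0 < b. Proof. exact: lt_trans b1. Qed.

Lemma univoque_code x : univoque_set N b x ->
  exists d, [/\ digits N d, seqval b d = x & unique_code d].
Proof.
move=> [d [dx H]]; exists d; split; first by case: dx.
  exact: expansion_val dx.
move=> e De ve; apply/esym/H; rewrite -(expansion_val dx) -ve.
exact: is_expansion_val.
Qed.

Lemma code_univoque d : digits N d -> unique_code d -> univoque_set N b (seqval b d).
Proof.
move=> D U; exists d; split; first exact: is_expansion_val.
move=> e ex; apply/esym/U; first by case: ex.
exact: expansion_val ex.
Qed.

Lemma unique_code_mirror d : digits N d -> unique_code d -> unique_code (mirror N d).
Proof.
move=> D U e De ve; rewrite -[LHS](mirrorK De); congr mirror.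
apply: U; first exact: mirror_digits.
by rewrite (seqval_mirror b1)// ve (seqval_mirror b1)// opprB addrC subrK.
Qed.

Lemma unique_code_tail d n : digits N d -> unique_code d -> unique_code (tail n d).
Proof.
move=> D U e De ve.
pose f i := if (i < n)%N then d i else e (i - n)%N.
have Df : digits N f by move=> i; rewrite /f; case: ifP.
have sf : tail n f = e.
  apply/funext => i; rewrite /tail /f ifF ?addKn//.
  by apply/negbTE; rewrite -leqNgt leq_addr.
have fd : f = d.
  apply: U => //; rewrite (seqval_split b1 n Df) (seqval_split b1 n D) sf ve.
  congr (_ + _).
  by apply: eq_big_nat => i /= ni; rewrite /f ni.
by rewrite -sf fd.
Qed.

(** If the tail had value at least 1, one could add 1 to the first digit and
    subtract 1 from the value of the tail, which yields a second expansion. *)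
Lemma unique_code_tail_lt1_head d : digits N d -> unique_code d -> (d 0%N < N.-1)%N ->
  seqval b (tail 1 d) < 1.
Proof.
move=> D U dN; rewrite ltNge; apply/negP => v1.
have D1 := tail_digits 1 D.
have [|e De ve] := @exists_expansion _ N b b1 (seqval b (tail 1 d) - 1) bN.
  by rewrite subr_ge0 v1/= (le_trans _ (seqval_lemax b1 D1))// lerBlDr lerDl.
pose f i := if i is i'.+1 then e i' else (d 0%N).+1.
have Df : digits N f by case=> [|i] /=; [lia|exact: De].
have tf : tail 1 f = e by apply/funext.
have fd : f = d.
  apply: U => //; rewrite (seqvalS b1 Df) (seqvalS b1 D) tf ve /f -natr1; congr (_ / _).
  ring.
have : f 0%N = d 0%N by rewrite fd.
by rewrite /f; lia.
Qed.

(** One digit below N - 1 controls all later tails: after a digit N - 1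
    the value [v] of the next tail satisfies (N - 1 + v) / b < 1 by induction,
    hence v < b - N + 1 <= 1. *)
Lemma unique_code_tail_lt1 d : digits N d -> unique_code d -> (d 0%N < N.-1)%N ->
  forall n, seqval b (tail n.+1 d) < 1.
Proof.
move=> D U dN; elim=> [|n IH]; first exact: unique_code_tail_lt1_head.
have Dn := tail_digits n.+1 D.
have := @unique_code_tail_lt1_head _ Dn (unique_code_tail D U).
rewrite tail_tail addn1 => H.
have [dn|dn] := ltnP (tail n.+1 d 0) N.-1; first exact: H.
have dE : tail n.+1 d 0 = N.-1 by have := Dn 0%N; lia.
move: IH; rewrite (seqvalS b1 Dn) tail_tail addn1 dE ltr_pdivrMr// mul1r.
have -> : (N.-1)%:R = N%:R - 1 :> R.
  by apply: natr_pred; have := D 0%N; lia.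
by move: bN; lra.
Qed.

Lemma psum_decr d (b' : R) n : b <= b' -> psum b' d n <= psum b d n.
Proof.
move=> bb; apply: ler_sum => i _; rewrite ler_wpM2l// lef_pV2 ?posrE ?exprn_gt0//.
  by rewrite lerXn2r// ?nnegrE ltW// (lt_le_trans b0).
exact: lt_le_trans bb.
Qed.

(** At the first place where [d] exceeds the quasi-greedy expansion at [bU], the
    maximality of the latter makes a partial sum of [d] reach 1 at [bU], and
    therefore at the smaller base [b] too. *)
Lemma lexle_of_val_lt1 (bU : R) d : b <= bU -> digits N d -> seqval b d < 1 ->
  lexle d (quasi_greedy N bU).
Proof.
move=> bbU D v1 j dj; rewrite leqNgt; apply/negP => qd.
have := quasi_greedy_max (D j) qd; apply/negP; rewrite -ltNge.
have -> : psum bU (quasi_greedy N bU) j = psum bU d j.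
  by apply: eq_big_nat => i /= /dj ->.
rewrite -psumSr; apply: le_lt_trans v1.
by apply: le_trans (psum_decr _ _ bbU) (seqval_ge b1 _ D).
Qed.

End unique_lex.

(** * Counting prefixes *)
Lemma eq_mkseq_lt (d e : nat -> nat) n :
  (forall i, (i < n)%N -> d i = e i) -> mkseq d n = mkseq e n.
Proof.
by move=> H; apply/eq_in_map => i; rewrite mem_iota add0n => /andP[_ /H].
Qed.

Section covers.
Context {R : realType}.
Implicit Types (S : set (nat -> nat)) (x : R).

(** At most [x] words are needed to list the prefixes of length [n] of [S]. The
    real bound makes the geometric estimates below direct, and it spares
    cardinalities of sets of prefixes. *)
Definition pcover S n x := exists2 l : seq (seq nat),
  (size l)%:R <= x & forall d, S d -> mkseq d n \in l.

Lemma pcover_le S n x y : x <= y -> pcover S n x -> pcover S n y.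
Proof. by move=> xy [l lx Sl]; exists l => //; exact: le_trans lx xy. Qed.

Lemma pcover_sub S S' n x :
  S `<=` S' -> pcover S' n x -> pcover S n x.
Proof. by move=> SS [l lx Sl]; exists l => // d /SS/Sl. Qed.

Lemma pcover1 S n x w :
  1 <= x -> (forall d, S d -> mkseq d n = w) -> pcover S n x.
Proof. by move=> x1 Sw; exists [:: w] => // d /Sw ->; rewrite mem_head. Qed.

Lemma pcover0 S n x : 0 <= x -> (forall d, ~ S d) -> pcover S n x.
Proof. by move=> x0 S0; exists [::] => // d /S0. Qed.

Lemma pcoverU S S' n x x' :
  pcover S n x -> pcover S' n x' -> pcover (S `|` S') n (x + x').
Proof.
move=> [l lx Sl] [l' lx' Sl']; exists (l ++ l').
  by rewrite size_cat natrD lerD.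
by move=> d [/Sl|/Sl'] dl; rewrite mem_cat dl ?orbT.
Qed.

(** The usual way of counting: the prefixes of [S] are recovered from shorter
    prefixes of other sequences. *)
Lemma pcover_image S S' (g : seq nat -> seq nat) n n' x :
  (forall d, S d -> exists2 d', S' d' & mkseq d n = g (mkseq d' n')) ->
  pcover S' n' x -> pcover S n x.
Proof.
move=> H [l lx Sl]; exists (map g l); first by rewrite size_map.
by move=> d /H[d' /Sl d'l ->]; exact: map_f.
Qed.

Lemma pcover_bigcup (S : nat -> set (nat -> nat)) m k n x : 0 <= x ->
  (forall j, (m <= j < m + k)%N -> pcover (S j) n x) ->
  pcover (\bigcup_(j in [set j | m <= j < m + k]%N) S j) n (k%:R * x).
Proof.
move=> x0; elim: k => [|k IH] H.
  by apply: pcover0 => [|d [j /=]]; rewrite ?mul0r// addn0; lia.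
rewrite -natr1 mulrDl mul1r; apply: (@pcover_sub _
    (\bigcup_(j in [set j | m <= j < m + k]%N) S j `|` S (m + k)%N)).
  move=> d [j /= jk]; have [->|jk'] := eqVneq j (m + k)%N => Sj; first by right.
  by left; exists j => //=; lia.
apply: pcoverU; first by apply: IH => j jk; apply: H; lia.
by apply: H; lia.
Qed.

Lemma mkseq_tail d m n : mkseq d (m + n) = mkseq d m ++ mkseq (tail m d) n.
Proof.
rewrite /mkseq iotaD map_cat; congr (_ ++ _).
by rewrite add0n -[in LHS](addn0 m) iotaDl -map_comp.
Qed.

Lemma pcover_cons S S' n x y :
  (forall d, S d -> d 0%N = y /\ S' (tail 1 d)) ->
  pcover S' n x -> pcover S n.+1 x.
Proof.
move=> H; apply: (pcover_image (g := cons y)) => d /H[d0 Sd].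
by exists (tail 1 d) => //; rewrite -add1n mkseq_tail /= d0.
Qed.

Lemma mkseq_mirror N d n : mkseq (mirror N d) n = compl_block N (mkseq d n).
Proof. by rewrite /compl_block /mkseq -map_comp. Qed.

Lemma pcover_mirror N S S' n x : (forall d, S d -> digits N d) ->
  (forall d, S d -> S' (mirror N d)) -> pcover S' n x -> pcover S n x.
Proof.
move=> SD SS; apply: (pcover_image (g := compl_block N)) => d Sd.
by exists (mirror N d); [exact: SS | rewrite -mkseq_mirror mirrorK//; exact: SD].
Qed.

End covers.

(** * Sequences that start like the generalized Thue-Morse sequence *)
Section lex_bounded.
Variables (N : nat) (th : nat -> nat).

Definition lex_bounded : set (nat -> nat) := [set d | digits N d /\
  forall n, lexle (tail n d) th /\ lexle (tail n (mirror N d)) th].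

Lemma lex_bounded_tail n d : lex_bounded d -> lex_bounded (tail n d).
Proof.
move=> [D H]; split; first exact: tail_digits.
by move=> k; rewrite -tail_mirror !tail_tail; exact: H.
Qed.

Lemma lex_bounded_mirror d : lex_bounded d -> lex_bounded (mirror N d).
Proof.
move=> [D H]; split; first exact: mirror_digits.
by move=> k; rewrite mirrorK//; have [? ?] := H k.
Qed.

End lex_bounded.

Section doubling.
Variables (N : nat) (th : nat -> nat) (p : nat).
Hypothesis p0 : (0 < p)%N.

Definition level m := (2 ^ m * p)%N.
Let L := level.

Hypothesis thD : forall m i, (i < L m)%N ->
  th (L m + i)%N = (compl_digit N (th i) + (i.+1 == L m))%N.

Definition theta_prefixed m : set (nat -> nat) :=
  [set d | lex_bounded N th d /\ forall i, (i < L m)%N -> d i = th i].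

Lemma levelS m : L m.+1 = (L m + L m)%N.
Proof. by rewrite /L /level expnS; lia. Qed.

Lemma level_gt m : (m < L m)%N.
Proof. by apply: leq_trans (ltn_expl m (ltnSn 1)) _; rewrite /L /level leq_pmulr. Qed.

(** The upper bound for [d] and the lower bound for its tail squeeze the next
    [L m] digits between the mirror image of the first [L m] terms of [th] and
    the lexicographic successor of that block. *)
Lemma theta_prefixed_step m d : theta_prefixed m d ->
  theta_prefixed m.+1 d \/ theta_prefixed m (mirror N (tail (L m) d)).
Proof.
move=> [Vd dth]; have [D H] := Vd.
have key i : (i < L m)%N ->
    (forall k, (k < i)%N -> d (L m + k)%N = compl_digit N (th k)) ->
    (compl_digit N (th i) <= d (L m + i) <= compl_digit N (th i) + (i.+1 == L m))%N.
  move=> iL IH; have LD k : (k < i)%N -> (th k < N)%N.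
    by move=> ki; rewrite -dth ?D//; lia.
  apply/andP; split.
    have [_ Hlo] := H (L m); have := D (L m + i)%N.
    suff : (tail (L m) (mirror N d) i <= th i)%N.
      by rewrite /tail /mirror /compl_digit; lia.
    apply: Hlo => k ki; rewrite /tail /mirror IH//.
    by have := LD _ ki; rewrite /compl_digit; lia.
  rewrite -thD//; have [/(_ (L m + i)%N) Hup _] := H 0%N.
  apply: Hup => k kL; have [kL'|Lk] := ltnP k (L m); first exact: dth.
  rewrite /tail add0n -(subnKC Lk) IH ?thD; try lia.
have eqc i : (i.+1 < L m)%N -> d (L m + i)%N = compl_digit N (th i).
  elim/ltn_ind: i => i IH iL; have := key i (ltnW iL).
  rewrite (_ : (i.+1 == L m) = false) ?addn0; last lia.
  move=> H'; apply/eqP; rewrite eq_sym eqn_leq; apply: H' => k ki.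
  by apply: IH => //; lia.
have L0 : (0 < L m)%N by have := level_gt m; lia.
have LP : (L m).-1.+1 = L m by rewrite prednK.
have /andP[lo up] := key (L m).-1 (ltac:(lia)) (fun k kL => eqc k (ltac:(lia))).
move: up; rewrite LP eqxx => up.
have [dE|dE] := eqVneq (d (L m + (L m).-1)%N) (compl_digit N (th (L m).-1)).
  right; split; first exact/lex_bounded_mirror/lex_bounded_tail.
  move=> i iL; have := D i; rewrite (dth _ iL) /mirror /tail.
  have [iL'|iL'] := ltnP i.+1 (L m); first by rewrite eqc// /compl_digit; lia.
  have -> : i = (L m).-1 by lia.
  by rewrite dE /compl_digit; lia.
left; split => // i; rewrite levelS => iL.
have [iL'|Li] := ltnP i (L m); first exact: dth.
rewrite -(subnKC Li) thD; last lia.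
have [jL|jL] := ltnP (i - L m).+1 (L m).
  by rewrite eqc// (_ : (_ == _) = false) ?addn0//; lia.
have -> : (i - L m)%N = (L m).-1 by lia.
by rewrite LP eqxx; lia.
Qed.

Section counting.
Context {R : realType}.
Variable tau : R.
Hypothesis tau1 : 1 < tau.

Let t0 : 0 < tau. Proof. exact: lt_trans tau1. Qed.

Lemma pcover_theta_prefixed_short m n (x : R) :
  1 <= x -> (n <= L m)%N -> pcover (theta_prefixed m) n x.
Proof.
move=> x1 nL; apply: (@pcover1 _ _ _ _ (mkseq th n)) => // d [_ dth].
by apply: eq_mkseq_lt => i iN; apply: dth; exact: leq_trans nL.
Qed.

Lemma pcover_theta_prefixed_rec m n (x x' : R) : (L m <= n)%N ->
  pcover (theta_prefixed m.+1) n x ->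
  pcover (theta_prefixed m) (n - L m) x' ->
  pcover (theta_prefixed m) n (x + x').
Proof.
move=> Ln c c'.
pose S : set (nat -> nat) :=
  [set d | theta_prefixed m d /\ theta_prefixed m (mirror N (tail (L m) d))].
apply: (@pcover_sub _ _ (theta_prefixed m.+1 `|` S)).
  by move=> d Sd; have [|] := theta_prefixed_step Sd; [left | right; split].
apply: pcoverU => //.
apply: (pcover_image (g := fun w => mkseq th (L m) ++ compl_block N w)) c'.
move=> d [Sd Sm].
exists (mirror N (tail (L m) d)) => //.
have [[D _] dth] := Sd.
rewrite -mkseq_mirror mirrorK; last exact: tail_digits.
rewrite -{1}(subnKC Ln) mkseq_tail; congr (_ ++ _).
exact: eq_mkseq_lt.
Qed.

(** The recursion T_m(n) <= T_(m+1)(n) + T_m(n - L m) for the number T_m(n) of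
    prefixes is solved by K_m tau ^ n as soon as
    K_(m+1) + K_m tau ^ (- L m) <= K_m. Since L m grows exponentially, the
    constants K_m = 1 + 2 ^ - (m - M) will do from some level M on. The
    induction on [m] runs downwards from [n <= m], where [n <= L m]. *)
Lemma pcover_theta_prefixed_deep M m n :
  (forall j, 2 ^+ j.+2 <= tau ^+ L (M + j)) -> (M <= m)%N ->
  pcover (theta_prefixed m) n ((1 + 2 ^- (m - M)) * tau ^+ n).
Proof.
move=> HM; move: m; elim/ltn_ind: n => n IHn m.
have [k] := ubnP (n - m); elim: k m => // k IHk m mk Mm.
have tn i : 1 <= tau ^+ i by apply: exprn_ege1; exact: ltW.
have p2 j : 0 < 2 ^- j :> R by rewrite invr_gt0 exprn_gt0.
have [nL|Ln] := leqP n (L m).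
  by apply: pcover_theta_prefixed_short => //; have := p2 (m - M)%N; have := tn n; nra.
have mn : (m < n)%N by apply: ltn_trans Ln; exact: level_gt.
have L0 : (0 < L m)%N by have := level_gt m; lia.
apply: pcover_le; last first.
  apply: pcover_theta_prefixed_rec; first exact: ltnW.
    by apply: IHk; lia.
  by apply: IHn => //; lia.
rewrite subSn//; have := HM (m - M)%N; rewrite subnKC//.
have -> : tau ^+ n = tau ^+ L m * tau ^+ (n - L m) by rewrite -exprD subnKC// ltnW.
have := tn (n - L m)%N; have := p2 (m - M)%N; rewrite !exprS !invfM.
have : 1 <= 2 ^+ (m - M) :> R by apply: exprn_ege1; rewrite ler1n.
set z := 2 ^+ (m - M); set Tl := tau ^+ L m; set y := tau ^+ (n - L m).
move=> z1 zi0 y1 H2.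
have zz : z * z^-1 = 1 by rewrite divff// gt_eqF// (lt_le_trans ltr01).
have zi1 : z^-1 <= 1 by nra.
have -> : (1 + 2^-1 * z^-1) * (Tl * y) + (1 + z^-1) * y =
  ((1 + 2^-1 * z^-1) * Tl + (1 + z^-1)) * y by ring.
rewrite mulrA ler_pM2r; last lra.
suff : 1 + z^-1 <= 2^-1 * z^-1 * Tl by lra.
apply: (@le_trans _ _ (2^-1 * z^-1 * (2 * (2 * z)))); last first.
  by rewrite ler_pM2l// mulr_gt0// invr_gt0.
have -> : 2^-1 * z^-1 * (2 * (2 * z)) = 2 * (z * z^-1) by field; rewrite gt_eqF//; lra.
by rewrite zz; lra.
Qed.

(** At a fixed level the solution of the recursion is a geometric series of
    ratio [q] = tau ^ (- L m) < 1. *)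
Lemma pcover_theta_prefixed_lift m (K : R) :
  (forall n, pcover (theta_prefixed m.+1) n (K * tau ^+ n)) ->
  exists K' : R, forall n, pcover (theta_prefixed m) n (K' * tau ^+ n).
Proof.
move=> H; have L0 : (0 < L m)%N by have := level_gt m; lia.
pose q := tau ^- L m.
have q0 : 0 < q by rewrite invr_gt0 exprn_gt0.
have q1 : q < 1 by rewrite invf_lt1 ?exprn_gt0// exprn_egt1//; lia.
exists (1 + `|K| / (1 - q)) => n; elim/ltn_ind: n => n IH.
have K0 : 0 <= `|K| / (1 - q) by rewrite divr_ge0// subr_ge0 ltW.
have [nL|Ln] := leqP n (L m).
  apply: pcover_theta_prefixed_short => //.
  have : 1 <= tau ^+ n by apply: exprn_ege1; exact: ltW.
  nra.
apply: pcover_le; last first.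
  apply: pcover_theta_prefixed_rec; [exact: ltnW | exact: H |].
  by apply: IH; lia.
have -> : tau ^+ (n - L m) = q * tau ^+ n.
  by rewrite -[in RHS](subnKC (ltnW Ln)) exprD mulrA mulVf ?mul1r// expf_neq0// gt_eqF.
rewrite mulrA -mulrDl ler_pM2r ?exprn_gt0//.
have : `|K| / (1 - q) = q * (`|K| / (1 - q)) + `|K|.
  by field; rewrite subr_eq0 gt_eqF.
by have := ler_norm K; set a := `|K| / (1 - q); set Ka := `|K|; nra.
Qed.

(** The entropy of the Thue-Morse-like sequences is zero: every base [tau] > 1
    bounds their growth. *)
Lemma pcover_theta_prefixed :
  exists K : R, forall n, pcover (theta_prefixed 0) n (K * tau ^+ n).
Proof.
have [k Hk] : exists k, 4 <= tau ^+ k.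
  have : (fun n => tau ^- n) @ \oo --> (0 : R) by exact: expn_cvg0.
  move=> /cvgrPdist_lt /(_ (1/5) ltac:(lra))[k _ /(_ k (leqnn k))].
  rewrite sub0r normrN ger0_norm ?invr_ge0 ?exprn_ge0 ?(ltW t0)//.
  move=> kk; exists k; rewrite -lef_pV2 ?posrE ?exprn_gt0// ltW//.
  by apply: lt_trans kk _; lra.
have HM j : 2 ^+ j.+2 <= tau ^+ L (k + j).
  have kL : (k <= 2 ^ k * p)%N by have := level_gt k; rewrite /L /level; lia.
  apply: (@le_trans _ _ (4 ^+ (2 ^ j))).
    rewrite (_ : 4 = 2 ^+ 2); last by rewrite -natrX.
    rewrite -exprM ler_eXn2l ?ltr1n//.
    by have := ltn_expl j (ltnSn 1); lia.
  rewrite (_ : L (k + j) = (2 ^ k * p * 2 ^ j)%N); last by rewrite /L /level expnD; lia.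
  rewrite exprM lerXn2r ?nnegrE// ?exprn_ge0 ?(ltW t0)//.
  by apply: le_trans Hk _; rewrite ler_weXn2l// ltW.
suff H i : (i <= k)%N ->
    exists K : R, forall n, pcover (theta_prefixed (k - i)) n (K * tau ^+ n).
  by have := H k (leqnn k); rewrite subnn.
elim: i => [_|i IH ik].
  exists (1 + 2 ^- 0) => n; rewrite subn0.
  by have := @pcover_theta_prefixed_deep k k n HM (leqnn k); rewrite subnn.
have [K HK] := IH (ltnW ik); apply: (@pcover_theta_prefixed_lift _ K).
by rewrite -subSn// subSS.
Qed.

End counting.
End doubling.

Section thue_morse_facts.
Variables (N : nat) (s : seq nat).
Hypothesis s0 : (0 < size s)%N.

Lemma size_thue_morse_block m :
  size (thue_morse_block N s m) = level (size s) m.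
Proof.
elim: m => [|m IH]; first by rewrite /level expn0 mul1n.
rewrite /= size_cat IH /incr_last size_incr_nth size_map IH levelS//.
by rewrite ifT//; have := level_gt s0 m; lia.
Qed.

Lemma nth_thue_morse_block m k i : (i < level (size s) m)%N ->
  nth 0%N (thue_morse_block N s (m + k)) i = nth 0%N (thue_morse_block N s m) i.
Proof.
move=> im; elim: k => [|k IH]; first by rewrite addn0.
rewrite addnS /= nth_cat size_thue_morse_block ifT ?IH//.
by apply: leq_trans im _; rewrite /level leq_mul2r leq_exp2l// leq_addr orbT.
Qed.

Lemma thue_morseE m i : (i < level (size s) m)%N ->
  thue_morse N s i = nth 0%N (thue_morse_block N s m) i.
Proof.
move=> im; rewrite /thue_morse.
have [mi|im'] := leqP m i; first by rewrite -(subnKC mi) nth_thue_morse_block ?subnKC.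
rewrite -[in RHS](subnKC (ltnW im')) nth_thue_morse_block//.
exact: level_gt.
Qed.

Lemma thue_morse_doubling m i : (i < level (size s) m)%N ->
  thue_morse N s (level (size s) m + i)
    = (compl_digit N (thue_morse N s i) + (i.+1 == level (size s) m))%N.
Proof.
move=> im; rewrite (@thue_morseE m.+1); last by rewrite levelS// ltn_add2l.
rewrite /= nth_cat size_thue_morse_block ifF ?addKn; last first.
  by apply/negbTE; rewrite -leqNgt leq_addr.
rewrite /incr_last nth_incr_nth size_map size_thue_morse_block.
rewrite (nth_map 0%N) ?size_thue_morse_block// -thue_morseE// addnC; congr (_ + _)%N.
by congr nat_of_bool; apply/eqP/eqP; have := level_gt s0 m; lia.
Qed.

End thue_morse_facts.

(** * Growth of the lexicographically bounded sequences *)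
Section growth.
Context {R : realType}.
Variables (N t1 t2 : nat) (th : nat -> nat) (tau : R).
Let c := (N.-1 - t1)%N.
Hypotheses (t1N : (t1 < N)%N) (ct2 : (c <= t2)%N) (t21 : (t2 < t1)%N).
Hypotheses (th0 : th 0%N = t1) (th1 : th 1%N = t2.+1).
Hypothesis thD : forall m i, (i < level 2 m)%N ->
  th (level 2 m + i)%N = (compl_digit N (th i) + (i.+1 == level 2 m))%N.
Hypothesis tau1 : 1 < tau.
Hypothesis tau_a : (t1 - c)%:R - 1 < tau.
Hypothesis tau_char : 0 < (tau - 1) * (tau - ((t1 - c)%:R - 1)) - 2 * (t2 - c)%:R.

Let V := lex_bounded N th.
Let W x : set (nat -> nat) := [set d | V d /\ d 0%N = x].

Let t0 : 0 < tau. Proof. exact: lt_trans tau1. Qed.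
Let tn n : 1 <= tau ^+ n. Proof. by apply: exprn_ege1; exact: ltW. Qed.

Lemma lex_bounded_head d : V d -> (c <= d 0 <= t1)%N.
Proof.
move=> [D H]; have [H1 H2] := H 0%N.
have := H1 0%N (fun i => ltac:(done)); have := H2 0%N (fun i => ltac:(done)).
by have := D 0%N; rewrite /tail /mirror /compl_digit th0 /c !addn0; lia.
Qed.

(** The only way to leave the subshift: t1 (t2 + 1) is how [th] starts. *)
Lemma lex_bounded_next d : W t1 d -> (d 1 <= t2)%N \/ theta_prefixed N th 2 0 d.
Proof.
move=> [Vd d0]; have [D H] := Vd; have [/(_ 1%N) H1 _] := H 0%N.
have d1 : (d 1 <= t2.+1)%N.
  by rewrite -th1; apply: H1 => -[|//] _; rewrite /tail d0 th0.
have [dE|dE] := eqVneq (d 1%N) t2.+1; last by left; lia.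
by right; split => // -[|[|//]] _; rewrite ?d0 ?dE ?th0 ?th1.
Qed.

Lemma headed_mirror d : W c d -> W t1 (mirror N d).
Proof.
move=> [Vd d0]; split; first exact: lex_bounded_mirror.
by rewrite /mirror /compl_digit d0 /c; lia.
Qed.

Lemma pcover_headed x n (u v : R) : 0 <= u -> 0 <= v ->
  (forall y, (c < y < t1)%N -> pcover (W y) n u) -> pcover (W t1) n v ->
  pcover (W x) n.+1 ((t1 - c)%:R * u - u + 2 * v).
Proof.
move=> u0 v0 Hu Hv.
have Hc : pcover (W c) n v.
  by apply: (pcover_mirror (N := N)) Hv => d; [case=> -[] | exact: headed_mirror].
have k : (c + 1 + (t1 - c - 1) = t1)%N by lia.
have B : pcover (\bigcup_(j in
    [set j | (c + 1 <= j < c + 1 + (t1 - c - 1))%N]) W j) n ((t1 - c - 1)%:R * u).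
  by apply: pcover_bigcup => // j; rewrite k => jk; apply: Hu; lia.
have := pcoverU (pcoverU B Hv) Hc; rewrite k natrB; last lia.
move=> {}B; apply: pcover_le (pcover_cons (y := x) _ B); first lra.
move=> d [Vd d0]; split => //.
have Vt := lex_bounded_tail 1 Vd; have := lex_bounded_head Vt => Hh.
have [E|E] := eqVneq (tail 1 d 0) c; first by right.
have [E'|E'] := eqVneq (tail 1 d 0) t1; first by left; right.
by left; left; exists (tail 1 d 0%N) => //=; lia.
Qed.

Lemma pcover_headed_top n (u v x : R) : 0 <= u -> 0 <= v ->
  (forall y, (c < y < t1)%N -> pcover (W y) n u) -> pcover (W t1) n v ->
  pcover (theta_prefixed N th 2 0) n.+1 x ->
  pcover (W t1) n.+1 ((t2 - c)%:R * u + v + x).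
Proof.
move=> u0 v0 Hu Hv Hx.
have Hc : pcover (W c) n v.
  by apply: (pcover_mirror (N := N)) Hv => d; [case=> -[] | exact: headed_mirror].
have B : pcover (\bigcup_(j in [set j | (c.+1 <= j < c.+1 + (t2 - c))%N]) W j) n
   ((t2 - c)%:R * u).
  by apply: pcover_bigcup => // j jk; apply: Hu; lia.
have {}B := pcoverU B Hc.
pose S : set (nat -> nat) := [set d | W t1 d /\ (d 1 <= t2)%N].
apply: (@pcover_sub _ _ (S `|` theta_prefixed N th 2 0)).
  by move=> d Wd; have [|] := lex_bounded_next Wd; [left; split | right].
apply: pcoverU => //; apply: (pcover_cons (y := t1) _ B).
move=> d [[Vd d0] d1]; split => //.
have Vt := lex_bounded_tail 1 Vd; have := lex_bounded_head Vt => Hh.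
have [E|E] := eqVneq (tail 1 d 0) c; first by right.
left; exists (tail 1 d 0%N) => //=; move: Hh E; rewrite /tail addn0; lia.
Qed.

(** The constants [u] (middle first digit) and [v] (first digit t1) solve the
    linear system (t1 - c - 1) u + 2 v = tau u, (t2 - c) u + v + K2 = tau v, in
    which [K2] dominates the Thue-Morse-like sequences. It has a positive
    solution because [tau] exceeds the Perron root, that is, because [tau_a] and
    [tau_char] hold. *)
Lemma pcover_lex_bounded :
  exists2 C : R, 0 <= C & forall n, pcover V n (C * tau ^+ n).
Proof.
have [K HK] := @pcover_theta_prefixed N th 2 (ltac:(done)) thD R tau tau1.
pose P := (tau - 1) * (tau - ((t1 - c)%:R - 1)) - 2 * (t2 - c)%:R.
pose K2 := `|K| * tau + P + P / (tau - ((t1 - c)%:R - 1)).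
pose w := K2 / P.
pose u := 2 * w.
pose v := (tau - ((t1 - c)%:R - 1)) * w.
have a0 : 0 < tau - ((t1 - c)%:R - 1) by rewrite subr_gt0.
have P0 : 0 < P by [].
have KK : 0 <= `|K| * tau by rewrite mulr_ge0// ltW.
have Pa : 0 < P / (tau - ((t1 - c)%:R - 1)) by rewrite divr_gt0.
(* The last two summands of [K2] make [u] and [v] at least 1, as is needed for
   words of length 0. *)
have K2K : K * tau <= K2.
  apply: (@le_trans _ _ (`|K| * tau)); first by rewrite ler_pM2r// ler_norm.
  by rewrite /K2; lra.
have K20 : 0 < K2 by rewrite /K2; lra.
have K2E : K2 = P * w by rewrite /w mulrC divfK// gt_eqF.
have u1 : 1 <= u by rewrite /u /w mulrA ler_pdivlMr// mul1r /K2; lra.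
have v1 : 1 <= v.
  by rewrite /v /w mulrA ler_pdivlMr// mul1r mulrC -ler_pdivrMr// /K2; lra.
have Eu : (t1 - c)%:R * u - u + 2 * v = tau * u.
  by rewrite /u /v; ring.
have Ev : (t2 - c)%:R * u + v + K2 = tau * v.
  by rewrite K2E /u /v /P; ring.
have ind n : (forall y, (c < y < t1)%N -> pcover (W y) n (u * tau ^+ n)) /\
             pcover (W t1) n (v * tau ^+ n).
  elim: n => [|n [IHu IHv]].
    by rewrite expr0 !mulr1; split=> [y _|]; apply: (@pcover1 _ _ _ _ [::]).
  have ut : 0 <= u * tau ^+ n by rewrite mulr_ge0 ?exprn_ge0 ?ltW// (lt_le_trans ltr01).
  have vt : 0 <= v * tau ^+ n by rewrite mulr_ge0 ?exprn_ge0 ?ltW// (lt_le_trans ltr01).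
  split=> [y _|].
    apply: pcover_le (pcover_headed y ut vt IHu IHv).
    have -> : u * tau ^+ n.+1 = tau * u * tau ^+ n by rewrite exprS; ring.
    rewrite -Eu; set z := tau ^+ n; lra.
  apply: pcover_le (pcover_headed_top ut vt IHu IHv (HK n.+1)).
  have -> : v * tau ^+ n.+1 = tau * v * tau ^+ n by rewrite exprS; ring.
  have : K * tau * tau ^+ n <= K2 * tau ^+ n by rewrite ler_pM2r// exprn_gt0.
  by rewrite -Ev exprS; set z := tau ^+ n; lra.
exists (N%:R * (u + v)).
  by rewrite mulr_ge0//; lra.
move=> n; have [Hu Hv] := ind n.
have ut : 0 <= u * tau ^+ n by rewrite mulr_ge0 ?exprn_ge0 ?ltW// (lt_le_trans ltr01).
have vt : 0 <= v * tau ^+ n by rewrite mulr_ge0 ?exprn_ge0 ?ltW// (lt_le_trans ltr01).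
apply: (@pcover_sub _ _ (\bigcup_(j in [set j | (0 <= j < 0 + N)%N]) W j)).
  by move=> d Vd; exists (d 0%N) => //=; have [D _] := Vd; rewrite add0n; exact: D.
rewrite -mulrA; apply: pcover_bigcup => [|j _].
  by rewrite mulr_ge0 ?exprn_ge0 ?ltW//; lra.
rewrite mulrDl; have [E|E] := eqVneq j t1.
  by rewrite E; apply: pcover_le Hv; lra.
have [E'|E'] := eqVneq j c.
  rewrite E'; apply: (@pcover_le _ _ _ (v * tau ^+ n)); first lra.
  by apply: (pcover_mirror (N := N)) Hv => d; [case=> -[] | exact: headed_mirror].
have [E2|E2] := boolP (c < j < t1)%N; first by apply: pcover_le (Hu _ E2); lra.
apply: pcover0 => [|d [Vd d0]]; first lra.
have := lex_bounded_head Vd; rewrite d0; move: E E' E2; clear; lia.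
Qed.

End growth.

(** * Upper bound for the dimension *)
Section univoque_codes.
Context {R : realType}.
Variables (N : nat) (b bU : R).
Hypotheses (N2 : (2 <= N)%N) (b1 : 1 < b) (bN : b <= N%:R) (bbU : b <= bU).
Let th := quasi_greedy N bU.
Let V := lex_bounded N th.
Let A : set (nat -> nat) := [set d | digits N d /\ unique_code N b d].

Lemma unique_code_lexle d n : A d -> (d 0 < N.-1)%N -> lexle (tail n.+1 d) th.
Proof.
move=> [D U] d0; apply: (@lexle_of_val_lt1 _ N b b1) => //; first exact: tail_digits.
exact: (unique_code_tail_lt1 b1 bN).
Qed.

Lemma codes_tail n d : A d -> A (tail n d).
Proof. by move=> [D U]; split; [exact: tail_digits | exact: (unique_code_tail b1)]. Qed.

Lemma codes_mirror d : A d -> A (mirror N d).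
Proof.
move=> [D U]; split; first exact: mirror_digits.
exact: (unique_code_mirror b1).
Qed.

Lemma middle_head_lex_bounded d : A d -> (0 < d 0 < N.-1)%N -> V (tail 1 d).
Proof.
move=> Ad /andP[d0 dN]; split; first by case: (codes_tail 1 Ad).
move=> n; rewrite !tail_tail -tail_mirror tail_tail; split.
  exact: unique_code_lexle.
apply: unique_code_lexle; first exact: codes_mirror.
by rewrite /mirror /compl_digit; lia.
Qed.

(** The digit 0 gives the upper bounds for the tails, and the positive digit
    the lower ones. *)
Lemma zero_head_lex_bounded d : A d -> d 0%N = 0%N -> (0 < d 1)%N -> V (tail 2 d).
Proof.
move=> Ad d0 d1; split; first by case: (codes_tail 2 Ad).
move=> n; rewrite -[tail 2 d](tail_tail 1 1) -tail_mirror !tail_tail; split.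
  by rewrite addnA; apply: unique_code_lexle; rewrite // d0; lia.
rewrite add1n; apply: unique_code_lexle.
  exact/codes_mirror/codes_tail.
by rewrite /mirror /compl_digit /tail addn0; lia.
Qed.

Variables (tau C : R).
Hypotheses (tau1 : 1 < tau) (C0 : 0 <= C).
Hypothesis HV : forall n, pcover V n (C * tau ^+ n).

Let t0 : 0 < tau. Proof. exact: lt_trans tau1. Qed.
Let tn n : 1 <= tau ^+ n. Proof. by apply: exprn_ege1; exact: ltW. Qed.
Let W : set (nat -> nat) := [set d | digits N d /\ V (tail 1 d)].
Let A0 : set (nat -> nat) := [set d | A d /\ d 0%N = 0%N].
Let K1 := N%:R * (1 + C).

Lemma pcover_after_digit n : pcover W n (K1 * tau ^+ n).
Proof.
apply: (@pcover_sub _ _ (\bigcup_(j in [set j | (0 <= j < 0 + N)%N])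
    [set d | d 0%N = j /\ V (tail 1 d)])).
  by move=> d [D Vd]; exists (d 0%N) => //=; rewrite add0n; exact: D.
rewrite /K1 -mulrA; apply: pcover_bigcup => [|j _].
  by apply: mulr_ge0; [move: C0; lra | exact/exprn_ge0/ltW].
case: n => [|n].
  by apply: (@pcover1 _ _ _ _ [::]) => //; rewrite expr0; move: C0; lra.
apply: (pcover_le (x := C * tau ^+ n)); last first.
  by apply: (pcover_cons (y := j) _ (HV n)).
have := tn n; rewrite exprS; set z := tau ^+ n => z1.
have z0 : 0 <= z by exact: le_trans z1.
have : C * z <= C * (tau * z) by rewrite ler_wpM2l// ler_peMl// ltW.
have : 0 <= tau * z by rewrite mulr_ge0// ltW.
lra.
Qed.

Lemma pcover_zero_head :
  exists2 K : R, 0 <= K & forall n, pcover A0 n (K * tau ^+ n).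
Proof.
have K10 : 0 <= K1 by rewrite mulr_ge0//; move: C0; lra.
pose K := 1 + K1 / (tau - 1).
have K1K : 0 <= K1 / (tau - 1) by rewrite divr_ge0// subr_ge0 ltW.
exists K; first by rewrite /K; lra.
elim=> [|n IH].
  by apply: (@pcover1 _ _ _ _ [::]) => //; rewrite /K expr0; lra.
have B := pcoverU IH (pcover_after_digit n).
apply: pcover_le (pcover_cons (y := 0%N) (S := A0) _ B).
  have : K1 = (tau - 1) * (K1 / (tau - 1)) by rewrite mulrC divfK// gt_eqF// subr_gt0.
  move=> K1E; rewrite -mulrDl exprS mulrA ler_pM2r ?exprn_gt0//.
  by move: K1E tau1; rewrite /K; set w := K1 / _ => ->; lra.
move=> d [Ad d0]; split => //.
have [d1|d1] := posnP (d 1%N); first by left; split; [exact: codes_tail|].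
right; split; first by case: (codes_tail 1 Ad).
by rewrite tail_tail; exact: zero_head_lex_bounded.
Qed.

Lemma pcover_codes : exists K : R, forall n, pcover A n (K * tau ^+ n).
Proof.
have [K K0 HK] := pcover_zero_head; exists (K + K + K1) => n.
have HM : pcover [set d | A0 (mirror N d) /\ digits N d] n (K * tau ^+ n).
  by apply: (pcover_mirror (N := N)) (HK n) => d [].
rewrite !mulrDl.
apply: pcover_sub (pcoverU (pcoverU (HK n) HM) (pcover_after_digit n)).
move=> d Ad; have [D _] := Ad.
have [d0|d0] := posnP (d 0%N); first by left; left.
have [dN|dN] := ltnP (d 0%N) N.-1.
  by right; split=> //; apply: middle_head_lex_bounded => //; rewrite d0.
left; right; split => //; split; first exact: codes_mirror.
by have := D 0%N; rewrite /mirror /compl_digit; lia.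
Qed.

End univoque_codes.

Section upper_bound.
Context {R : realType}.

Lemma powR_exprVn (b s : R) n : 0 < b -> (b ^- n) `^ s = (b `^ s) ^- n.
Proof.
move=> b0; elim: n => [|n IH]; first by rewrite !expr0 invr1 powR1.
rewrite !exprS !invfM powRM ?invr_ge0 ?exprn_ge0 ?(ltW b0)// IH; congr (_ * _).
by rewrite -(powR_inv1 (ltW b0)) -powRrM mulN1r powRN.
Qed.

Lemma expn_small (b K eps : R) : 1 < b -> 0 < eps ->
  exists n0, forall n, (n0 <= n)%N -> K * b ^- n <= eps.
Proof.
move=> b1 e0.
have cK : (fun n => K * b ^- n) @ \oo --> (0 : R).
  by rewrite -[X in _ --> X](mulr0 K); apply: cvgMl_tmp; exact: expn_cvg0.
move: cK => /cvgrPdist_lt/(_ eps e0)[n0 _ H]; exists n0 => n /H /=.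
by rewrite sub0r normrN => /ltW; exact: le_trans (ler_norm _).
Qed.

(** The cylinders of length [n] that meet the codes number at most K tau ^ n and
    have diameter at most vmax b ^ - n, and (tau / b ^ s) ^ n tends to 0. *)
Lemma univoque_measure_eq0 N (b s tau K : R) : 1 < b -> b <= N%:R -> 0 <= s ->
  1 < tau -> tau < b `^ s ->
  (forall n, pcover [set d | digits N d /\ unique_code N b d] n (K * tau ^+ n)) ->
  hausdorff_measure s (univoque_set N b) = 0%E.
Proof.
move=> b1 bN s0 tau1 taub HK; apply: hausdorff_measure_eq0 => // eps e0.
have b0 : 0 < b by exact: lt_trans b1.
have t0 : 0 < tau by exact: lt_trans tau1.
have vm0 : 0 <= vmax N b.
  by rewrite divr_ge0// subr_ge0 ?(ltW b1)// (le_trans _ bN)// ltW.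
have q1 : 1 < b `^ s / tau by rewrite ltr_pdivlMr// mul1r.
have [n1 H1] := @expn_small b (vmax N b) eps b1 e0.
have [n2 H2] := @expn_small (b `^ s / tau) (K * vmax N b `^ s) eps q1 e0.
pose n := maxn n1 n2.
have [l lK Hl] := HK n.
pose F w : set R := [set x | exists d, [/\ digits N d, mkseq d n = w & seqval b d = x]].
exists (map F l), (vmax N b * b ^- n); split.
- by rewrite mulr_ge0 ?invr_ge0 ?exprn_ge0 ?(ltW b0)//= H1// leq_maxl.
- move=> x /(univoque_code b1)[d [D dx U]].
  have dl := Hl d (conj D U).
  exists (index (mkseq d n) l); rewrite (nth_map [::]) ?index_mem// nth_index//.
  by exists d.
- move=> i; have [il|li] := ltnP i (size l); last first.
    by rewrite nth_default ?size_map// //; apply: diameter_le.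
  rewrite (nth_map [::])//; apply: diameter_le => _ _ [d [D dw <-]] [e [De ew <-]].
  rewrite (seqval_split b1 n D) (seqval_split b1 n De).
  have -> : psum b d n = psum b e n.
    apply: eq_big_nat => j /= jn; congr (_%:R * _).
    by rewrite -(nth_mkseq 0%N d jn) dw -ew nth_mkseq.
  rewrite opprD addrACA subrr add0r -mulrBr mulrC normrM.
  rewrite (@ger0_norm _ (b ^- n)) ?invr_ge0 ?exprn_ge0 ?(ltW b0)//.
  rewrite ler_wpM2r ?invr_ge0 ?exprn_ge0 ?(ltW b0)//.
  have Dn := tail_digits n D; have En := tail_digits n De.
  have := seqval_ge0 b1 Dn; have := seqval_lemax b1 Dn.
  have := seqval_ge0 b1 En; have := seqval_lemax b1 En.
  by rewrite ler_norml; lra.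
- rewrite size_map powRM ?invr_ge0 ?exprn_ge0 ?(ltW b0)// powR_exprVn//.
  apply: le_trans (H2 n (leq_maxr _ _)).
  rewrite exprMn invfM exprVn invrK.
  have P0 : 0 <= vmax N b `^ s * (b `^ s) ^- n.
    by rewrite mulr_ge0 ?powR_ge0// invr_ge0 exprn_ge0// powR_ge0.
  apply: le_trans (ler_wpM2r P0 lK) _.
  set x := (b `^ s) ^- n; set y := tau ^+ n; lra.
Qed.

End upper_bound.

(** * A subshift of unique codes *)
Section inner_codes.
Context {R : realType}.
Variables (N t1 t2 : nat).
Let c := (N.-1 - t1)%N.
Hypotheses (t1N : (t1 < N)%N) (ct2 : (c <= t2)%N) (t21 : (t2 < t1)%N).

(** Equivalent to every tail of [d] being lexicographically at most
    (t1 t2)^oo, but stated by digit pairs. *)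
Definition below_period (d : nat -> nat) :=
  forall i, (d i <= t1)%N /\ (d i = t1 -> (d i.+1 <= t2)%N).

Definition inner d :=
  [/\ digits N d, below_period d & below_period (mirror N d)].

Lemma below_period_tail n d : below_period d -> below_period (tail n d).
Proof. by move=> H i; have := H (n + i)%N; rewrite /tail addnS. Qed.

Lemma inner_tail n d : inner d -> inner (tail n d).
Proof.
move=> [D H H']; split; [exact: tail_digits | exact: below_period_tail |].
by rewrite -tail_mirror; exact: below_period_tail.
Qed.

Lemma inner_mirror d : inner d -> inner (mirror N d).
Proof. by move=> [D H H']; split=> //; [exact: mirror_digits | rewrite mirrorK]. Qed.

Let per := periodic_seq [:: t1; t2].

Lemma tail_periodic : tail 2 per = per.
Proof. by apply/funext => i; rewrite /per /tail /periodic_seq /= modnDl. Qed.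

(** In the limit, the partial sums give value at most 1 for (t1 t2)^oo, which is
    (t1 b + t2) / (b ^ 2 - 1). Elementarily: if [a] > 0 were the excess in the
    inequality, the gap between 1 and the partial sums would lose at least [a]
    with every period. *)
Lemma period_bound (bL : R) : 1 < bL ->
  (forall n, psum bL per n < 1) -> t1%:R * bL + t2%:R + 1 <= bL ^+ 2.
Proof.
move=> b1 H; rewrite leNgt; apply/negP => a0.
have b0 : 0 < bL by exact: lt_trans b1.
pose a := t1%:R * bL + t2%:R + 1 - bL ^+ 2.
have {}a0 : 0 < a by rewrite subr_gt0.
have S k : psum bL per k.+2 = (t1%:R * bL + t2%:R + psum bL per k) / bL ^+ 2.
  rewrite !psumS tail_tail tail_periodic /per /tail /periodic_seq /=.
  by field; rewrite gt_eqF.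
have D k : 1 - psum bL per k.*2 <= 1 - k%:R * a.
  elim: k => [|k IH]; first by rewrite psum0 mul0r.
  have := H (k.+1).*2; rewrite doubleS S ltr_pdivrMr ?exprn_gt0// mul1r => lt1.
  have B : 1 <= bL ^+ 2 by apply: exprn_ege1; exact: ltW.
  have : 1 - (t1%:R * bL + t2%:R + psum bL per k.*2) / bL ^+ 2
     <= bL ^+ 2 - (t1%:R * bL + t2%:R + psum bL per k.*2).
    rewrite -[X in X - _ <= _](@divff _ (bL ^+ 2)) ?gt_eqF ?exprn_gt0// -mulrBl.
    rewrite ler_pdivrMr ?exprn_gt0// ler_peMr// subr_ge0 ltW//.
  move: IH; rewrite /a -natr1; lra.
have /andP[_] := truncn_itv (ltW (divr_gt0 ltr01 a0)).
set m := (Num.truncn _).+1; rewrite ltr_pdivrMr// => m1.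
by have := H m.*2; have := D m; lra.
Qed.

Lemma period_bound_mono (bL b : R) : 1 < bL -> bL <= b ->
  t1%:R * bL + t2%:R + 1 <= bL ^+ 2 -> t1%:R * b + t2%:R + 1 <= b ^+ 2.
Proof.
move=> b1 bLb H.
have b0 : 0 < b by apply: lt_le_trans bLb; exact: lt_trans b1.
apply: (@le_trans _ _ (b * bL)); last by rewrite expr2 ler_pM2l.
rewrite -(@ler_pM2r _ bL); last exact: lt_trans b1.
apply: (@le_trans _ _ (b * (t1%:R * bL + t2%:R + 1))).
  have : 0 <= t2%:R :> R by []; move: bLb; nra.
by rewrite -mulrA ler_pM2l// -expr2.
Qed.

Variable b : R.
Hypotheses (b1 : 1 < b) (bper : t1%:R * b + t2%:R + 1 <= b ^+ 2).

Let b0 : 0 < b. Proof. exact: lt_trans b1. Qed.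

Let t1b : t1%:R < b.
Proof.
have : 0 <= t2%:R :> R by [].
by move: bper b0 => h1 h2 h3; rewrite -(ltr_pM2r b0) -expr2; lra.
Qed.

Let bper' x : x <= 1 -> (t1%:R + (t2%:R + x) / b) / b <= 1.
Proof.
move=> x1; rewrite ler_pdivrMr// mul1r -lerBrDl ler_pdivrMr//.
by move: bper; rewrite expr2; nra.
Qed.

(** Induction on the length by one digit, or by two after a digit t1. *)
Lemma below_period_psum d n : below_period d -> psum b d n <= 1.
Proof.
elim/ltn_ind: n d => -[_ d _|[_ d H|n IH d H]]; first by rewrite psum0.
  rewrite psumS psum0 addr0 ler_pdivrMr// mul1r (le_trans _ (ltW t1b))// ler_nat.
  by have [] := H 0%N.
have [d0 d1] := H 0%N.
have [E|E] := eqVneq (d 0%N) t1.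
  rewrite psumS psumS E tail_tail; apply: le_trans (bper' (x := psum b (tail 2 d) n) _).
    rewrite ler_pM2r ?invr_gt0// lerD2l ler_pM2r ?invr_gt0// lerD2r ler_nat.
    exact: d1.
  by apply: IH; [lia | exact: below_period_tail].
rewrite psumS ler_pdivrMr// mul1r.
have : psum b (tail 1 d) n.+1 <= 1 by apply: IH; [lia | exact: below_period_tail].
have : (d 0%N).+1%:R <= t1%:R :> R by rewrite ler_nat; lia.
by rewrite -natr1; move: t1b; lra.
Qed.

Lemma below_period_val d : digits N d -> below_period d -> seqval b d <= 1.
Proof. by move=> D H; apply: (seqval_le b1 D) => n; exact: below_period_psum. Qed.

Lemma below_period_val_ge1 d : digits N d -> below_period d -> 1 <= seqval b d ->
  [/\ d 0%N = t1, d 1%N = t2 & 1 <= seqval b (tail 2 d)].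
Proof.
move=> D H v1; have [d0 d1] := H 0%N.
have D1 := tail_digits 1 D; have D2 := tail_digits 2 D.
have V1 := below_period_val D1 (below_period_tail 1 H).
have V2 := below_period_val D2 (below_period_tail 2 H).
have E : d 0%N = t1.
  apply/eqP; case: eqVneq => // E; exfalso.
  have : (d 0%N).+1%:R <= t1%:R :> R by rewrite ler_nat; lia.
  move: v1; rewrite (seqvalS b1 D) ler_pdivlMr// mul1r -natr1; move: t1b; lra.
have {}d1 := d1 E.
move: v1; rewrite (seqvalS b1 D) (seqvalS b1 D1) tail_tail E ler_pdivlMr// mul1r.
rewrite -lerBlDl ler_pdivlMr// => v1.
have E2 : d 1%N = t2.
  apply/eqP; case: eqVneq => // E2; exfalso.
  have : (d 1%N).+1%:R <= t2%:R :> R by rewrite ler_nat; lia.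
  move: v1; rewrite -natr1 /tail /= -/(tail 2 d); move: bper; rewrite expr2; lra.
split => //; move: v1; rewrite [tail 1 d 0%N]E2; move: bper; rewrite expr2; lra.
Qed.

(** Equality is possible only at the left endpoint of the admissible interval;
    this is the reason for excluding countably many codes later. *)
Lemma below_period_val_eq1 d : digits N d -> below_period d -> 1 <= seqval b d ->
  d = per.
Proof.
move=> D H v1; apply/funext => i.
suff : forall k, [/\ d k.*2 = t1, d k.*2.+1 = t2 & 1 <= seqval b (tail k.*2.+2 d)].
  move=> /(_ i./2)[d0 d1 _]; rewrite /per /periodic_seq /= modn2.
  by rewrite -{1}(odd_double_half i); case: (odd i); rewrite /= ?add0n ?add1n.
elim=> [|k [_ _ IH]]; first exact: below_period_val_ge1.
have := below_period_val_ge1 (tail_digits _ D) (below_period_tail _ H) IH.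
by rewrite tail_tail /tail doubleS !addn0 addn1 addn2.
Qed.

(** Two consecutive digits are never both 0: after c the digit is at least
    N - 1 - t2 > 0. *)
Lemma inner_val_ge d : inner d -> b ^- 2 <= seqval b d.
Proof.
move=> [D H H']; apply: le_trans (seqval_ge b1 2 D).
rewrite !psumSr psum0 add0r expr1.
have [d0|d0] := posnP (d 0%N).
  have := H' 0%N; rewrite /mirror /compl_digit d0 subn0 => -[M0 /(_ ltac:(lia)) M1].
  by rewrite mul0r add0r ler_peMl ?invr_ge0 ?exprn_ge0 ?(ltW b0)// ler1n; lia.
apply: (@le_trans _ _ ((d 0%N)%:R / b)); last first.
  by rewrite lerDl mulr_ge0// invr_ge0 exprn_ge0// ltW.
rewrite expr2 invfM ler_pM2r ?invr_gt0//.
by rewrite (@le_trans _ _ 1)// ?ler1n// invf_le1// ltW.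
Qed.

(** At the first difference the larger digit gains at least 1, which the tail of
    the other sequence, of value at most 1, can at best compensate; what remains
    is the value of the tail after the larger digit. *)
Lemma inner_separation d e n : inner d -> inner e ->
  (forall i, (i < n)%N -> d i = e i) -> d n <> e n ->
  b ^- n.+3 <= `|seqval b d - seqval b e|.
Proof.
wlog : d e / (d n < e n)%N => [W Id Ie H ne|].
  have [de|de|//] := ltngtP (d n) (e n); first exact: W.
  by rewrite distrC; apply: W => //; [move=> i /H | move/esym].
move=> de Id Ie H _; have [D Bd _] := Id; have [De _ _] := Ie.
rewrite distrC (seqval_split b1 n D) (seqval_split b1 n De).
have -> : psum b d n = psum b e n by apply: eq_big_nat => i /= /H ->.
rewrite opprD addrACA subrr add0r -mulrBr.
have Dn := tail_digits n D; have En := tail_digits n De.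
rewrite (seqvalS b1 Dn) (seqvalS b1 En) !tail_tail addn1 -mulrBl.
rewrite /tail !addn0 -!/(tail _ _).
have V1 := below_period_val (tail_digits n.+1 D) (below_period_tail n.+1 Bd).
have V2 := inner_val_ge (inner_tail n.+1 Ie).
have : (d n).+1%:R <= (e n)%:R :> R by rewrite ler_nat.
rewrite -natr1 => dE.
apply: le_trans (ler_norm _).
rewrite (_ : n.+3 = (n + (2 + 1))%N) ?exprD; last lia.
rewrite !invfM expr1 ler_wpM2l ?invr_ge0 ?exprn_ge0 ?(ltW b0)//.
rewrite ler_pM2r ?invr_gt0//; lra.
Qed.

(** If another expansion first differs by a larger digit, the tail of [d] after
    it must have value at least 1 and is therefore (t1 t2)^oo; a smaller digit
    reduces to this case by reflection. *)
Lemma inner_unique d : inner d -> (forall n, tail n d <> per) ->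
  (forall n, tail n (mirror N d) <> per) -> unique_code N b d.
Proof.
have key d' e : inner d' -> (forall n, tail n d' <> per) -> digits N e ->
    seqval b e = seqval b d' -> forall n, (forall i, (i < n)%N -> d' i = e i) ->
    (e n <= d' n)%N.
  move=> I NP De ve n H; rewrite leqNgt; apply/negP => ne.
  have [D B _] := I; apply: (NP n.+1).
  apply: below_period_val_eq1; [exact: tail_digits | exact: below_period_tail |].
  move: ve; rewrite (seqval_split b1 n D) (seqval_split b1 n De).
  have -> : psum b d' n = psum b e n by apply: eq_big_nat => i /= /H ->.
  move/addrI/mulfI; rewrite invr_eq0 expf_neq0 ?gt_eqF// => /(_ isT).
  have Dn := tail_digits n D; have En := tail_digits n De.
  rewrite (seqvalS b1 Dn) (seqvalS b1 En) !tail_tail addn1 => /divIf.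
  rewrite gt_eqF// => /(_ isT).
  have := seqval_ge0 b1 (tail_digits n.+1 De).
  have : (d' n).+1%:R <= (e n)%:R :> R by rewrite ler_nat.
  rewrite -natr1 /tail !addn0 -!/(tail _ _); lra.
move=> I NP NP' e De ve; apply/funext => n; elim/ltn_ind: n => n IH.
have [D _ _] := I.
have k1 := key _ _ I NP De ve n (fun i h => esym (IH i h)).
have k2 : (mirror N e n <= mirror N d n)%N.
  apply: (key _ (mirror N e) (inner_mirror I) NP' (mirror_digits De)).
    by rewrite (seqval_mirror b1 De) (seqval_mirror b1 D) ve.
  by move=> i /IH ie; rewrite /mirror ie.
by move: k2; rewrite /mirror /compl_digit; have := D n; have := De n; lia.
Qed.

End inner_codes.

(** * Coding an interval into the subshift *)
Section coding.
Context {R : realType}.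
Variables (N t1 t2 : nat) (rho : R).
Let c := (N.-1 - t1)%N.
Hypotheses (t1N : (t1 < N)%N) (ct2 : (c <= t2)%N) (t21 : (t2 < t1)%N).
Hypothesis rho1 : 1 < rho.
Hypothesis rho_char : (rho - 1) * (rho - ((t1 - c)%:R - 1)) = 2 * (t2 - c)%:R.

Definition allowed i j :=
  [&& (c <= j <= t1)%N, (i == t1) ==> (j <= t2)%N & (i == c) ==> (N.-1 - t2 <= j)%N].

(** A nonnegative right eigenvector of the transition matrix of [allowed], see
    [weight_eigen]; its entries for the extreme digits may vanish. *)
Definition weight j : R :=
  if (j == c) || (j == t1) then (t2 - c)%:R else rho - 1.

(** The left endpoint of the piece with digit [k] when an interval of length
    [rho * weight i] is cut into pieces of lengths [weight j]. *)
Definition offset i k : R := \sum_(0 <= j < k | allowed i j) weight j.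

Lemma sum_weight_mid p q : (c < p)%N -> (q <= t1)%N ->
  \sum_(p <= j < q) weight j = (q - p)%:R * (rho - 1).
Proof.
move=> cp qt; rewrite mulr_natl -sumr_const_nat; apply: eq_big_nat => j pj.
by rewrite /weight ifF//; apply/negbTE; lia.
Qed.

Lemma offsetE i p q : (p <= q <= N)%N ->
  (forall j, allowed i j = (p <= j < q)%N) -> offset i N = \sum_(p <= j < q) weight j.
Proof.
move=> /andP[pq qN] H; rewrite /offset (@big_cat_nat _ _ _ p)//=; last first.
  exact: leq_trans qN.
rewrite [X in X + _]big1_seq ?add0r; last first.
  by move=> j; rewrite mem_index_iota H; lia.
rewrite (@big_cat_nat _ _ _ q)//= [X in _ + X]big1_seq ?addr0; last first.
  by move=> j; rewrite mem_index_iota H; lia.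
rewrite big_nat_cond [RHS]big_nat_cond; apply: eq_bigl => j.
by rewrite H; case: (p <= j < q)%N.
Qed.

Lemma weight_eigen i : (c <= i <= t1)%N -> offset i N = rho * weight i.
Proof.
have wc : weight c = (t2 - c)%:R by rewrite /weight eqxx.
have wt : weight t1 = (t2 - c)%:R by rewrite /weight eqxx orbT.
move=> ci; have [->|it] := eqVneq i t1.
  rewrite (@offsetE _ c t2.+1); [|lia|by move=> j; rewrite /allowed eqxx; lia].
  rewrite big_ltn ?sum_weight_mid// wc wt subSS.
  ring.
have [->|ic] := eqVneq i c.
  rewrite (@offsetE _ (N.-1 - t2)%N t1.+1); [|lia|]; last first.
    by move=> j; rewrite /allowed eqxx; lia.
  rewrite big_nat_recr /=; last lia.
  rewrite sum_weight_mid// ?wc ?wt; last lia.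
  by rewrite (_ : (t1 - (N.-1 - t2))%N = (t2 - c)%N); [ring | rewrite /c; lia].
rewrite (@offsetE _ c t1.+1); [|lia|by move=> j; rewrite /allowed; lia].
rewrite big_ltn; last lia.
rewrite big_nat_recr /=; last lia.
rewrite sum_weight_mid// wc wt /weight ifF; last by rewrite (negbTE it) (negbTE ic).
rewrite (_ : (t1 - c.+1)%:R = (t1 - c)%:R - 1 :> R); last first.
  by rewrite subnS natr_pred//; lia.
by move: rho_char; lra.
Qed.

Lemma offset_pick i k x : 0 <= x < offset i k ->
  exists j, allowed i j /\ 0 <= x - offset i j < weight j.
Proof.
move=> /andP[x0]; elim: k => [|k IH]; first by rewrite /offset big_geq//; lra.
have [/IH//|xk] := ltP x (offset i k).
rewrite /offset big_mkcond big_nat_recr//= -big_mkcond -/(offset i k).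
have [ak|nak] := boolP (allowed i k); last by rewrite addr0 ltNge xk.
by move=> xk1; exists k; split => //; rewrite subr_ge0 xk ltrBlDl.
Qed.

Lemma ext_weight_ge0 : 0 <= (t2 - c)%:R :> R. Proof. by []. Qed.

(** The state is a digit [i] with a remainder that is at least 0 and less than
    [weight i]. Stretching the
    remainder by [rho] and finding the piece that contains it gives the next
    digit and remainder. Digits of weight 0 are never chosen, and parameters
    that share [n] digits differ by rho ^ - (n - 1) times a difference of two
    remainders. The start is the middle digit c + 1, of weight [rho - 1]. *)
Lemma exists_coding : (c.+1 < t1)%N -> exists D : R -> nat -> nat,
  forall y, 0 <= y < rho - 1 -> inner N t1 t2 (D y) /\
  forall y', 0 <= y' < rho - 1 -> forall n,
    (forall i, (i < n)%N -> D y i = D y' i) ->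
    `|y - y'| <= (rho - 1 + (t2 - c)%:R) * rho * rho ^- n.
Proof.
move=> ct1.
have r0 : 0 < rho by exact: lt_trans rho1.
pose P (z : nat * R) := (c <= z.1 <= t1)%N /\ 0 <= z.2 < weight z.1.
pose Q (z z' : nat * R) := allowed z.1 z'.1 /\ rho * z.2 = offset z.1 z'.1 + z'.2.
have step z : P z -> exists z', P z' /\ Q z z'.
  move=> [zc /andP[z0 zw]].
  have [|j [aj jw]] := @offset_pick z.1 N (rho * z.2).
    by rewrite weight_eigen// mulr_ge0 ?(ltW r0)//= ltr_pM2l.
  exists (j, rho * z.2 - offset z.1 j); split; first by split => //=; case/and3P: aj.
  by split => //=; rewrite addrC subrK.
have orb y : exists f : nat -> nat * R, 0 <= y < rho - 1 ->
    f 0%N = (c.+1, y) /\ forall n, P (f n) /\ Q (f n) (f n.+1).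
  have [yr|yr] := pselect (is_true (0 <= y < rho - 1)); last first.
    by exists (fun=> (0%N, 0)) => /yr.
  have [|f Hf] := orbit_exists step (x0 := (c.+1, y)); last by exists f.
  by split => /=; [lia | rewrite /weight ifF//; apply/negbTE; lia].
have [F HF] := choice orb.
exists (fun y n => (F y n).1) => y yr; have [f0 fS] := HF y yr; split.
  split=> i.
  - by have [[/andP[_ ?] _] _] := fS i; lia.
  - have [[/andP[_ ?] _] [/and3P[_ /implyP H _] _]] := fS i; split=> // E.
    by apply: H; rewrite E.
  - have [[/andP[a a'] _] [/and3P[_ _ /implyP H] _]] := fS i.
    rewrite /mirror /compl_digit; split; first by move: a; rewrite /c; lia.
    have ac : (F y i).1 == c -> (N.-1 - (F y i.+1).1 <= t2)%N by move/H; lia.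
    by move=> E; apply: ac; rewrite /c; move: a'; lia.
move=> y' yr'; have [f0' fS'] := HF y' yr'.
set M := rho - 1 + _.
have M0 : 0 <= M by have := ext_weight_ge0; rewrite /M; lra.
have wM j : weight j <= M.
  by have := ext_weight_ge0; rewrite /weight /M; case: ifP => _; lra.
have agree n : (forall i, (i < n.+1)%N -> (F y i).1 = (F y' i).1) ->
    y - y' = rho ^- n * ((F y n).2 - (F y' n).2).
  elim: n => [|n IH] H; first by rewrite f0 f0' expr0 invr1 mul1r.
  rewrite IH; last by move=> i iN; apply: H; lia.
  have [_ [_ E]] := fS n; have [_ [_ E']] := fS' n.
  have e1 := H n (leqnSn _); have e2 := H n.+1 (leqnn _).
  have -> : (F y n).2 - (F y' n).2 = ((F y n.+1).2 - (F y' n.+1).2) / rho.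
    apply: (mulfI (lt0r_neq0 r0)); rewrite mulrBr E E' -e1 -e2.
    rewrite mulrCA divff ?gt_eqF// mulr1.
    lra.
  by rewrite exprS invfM; ring.
case=> [|n] H.
  rewrite expr0 invr1 mulr1.
  have : M <= M * rho by rewrite ler_peMr// ltW.
  have : rho - 1 <= M by rewrite /M; have := ext_weight_ge0; lra.
  have := ext_weight_ge0.
  by rewrite ler_norml; lra.
rewrite (agree n H) normrM ger0_norm ?invr_ge0 ?exprn_ge0 ?(ltW r0)//.
rewrite exprS invfM mulrA mulfK ?gt_eqF// mulrC.
rewrite ler_wpM2r ?invr_ge0 ?exprn_ge0 ?(ltW r0)//.
have [[_ /andP[a1 a2]] _] := fS n; have [[_ /andP[a3 a4]] _] := fS' n.
have := wM (F y n).1; have := wM (F y' n).1.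
by rewrite ler_norml; lra.
Qed.

End coding.

(** * Lower bound for the dimension *)
Section lower_bound.
Context {R : realType}.
Variables (N t1 t2 : nat) (rho b s : R).
Let c := (N.-1 - t1)%N.
Hypotheses (t1N : (t1 < N)%N) (ct2 : (c <= t2)%N) (t21 : (t2 < t1)%N).
Hypothesis rho1 : 1 < rho.
Hypothesis rho_char : (rho - 1) * (rho - ((t1 - c)%:R - 1)) = 2 * (t2 - c)%:R.
Hypotheses (b1 : 1 < b) (bper : t1%:R * b + t2%:R + 1 <= b ^+ 2).
Hypotheses (s0 : 0 <= s) (bs : b `^ s <= rho).

(** Otherwise t1 = c + 1 and t2 = c, where the characteristic equation becomes
    (rho - 1) rho = 0. *)
Lemma middle_digit_exists : (c.+1 < t1)%N.
Proof.
rewrite ltnNge; apply/negP => t1c.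
have tc : t2 = c by lia.
have tc1 : t1 = c.+1 by lia.
move: rho_char; rewrite tc subnn mulr0 [in X in X = _]tc1 subSnn subrr subr0.
by move=> /eqP; rewrite mulf_eq0 subr_eq0 !gt_eqF// (lt_trans _ rho1).
Qed.

(** Such a parameter is determined by the finite prefix that precedes the fixed
    tail and by the choice between the two tails. *)
Lemma countable_fixed_tails (D : R -> nat -> nat) (P : set R)
    (p q : nat -> nat) :
  (forall y y', P y -> P y' -> D y = D y' -> y = y') ->
  countable [set y | P y /\ exists n, tail n (D y) = p \/ tail n (D y) = q].
Proof.
move=> inj.
pose F (w : seq nat * bool) := [set y | P y /\ exists n,
  mkseq (D y) n = w.1 /\ tail n (D y) = if w.2 then p else q].
have cF : countable (\bigcup_(w in [set: seq nat * bool]) F w).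
  apply: bigcup_countable => // w _.
  have [[y0 [Py0 [n [w0 e0]]]]|NF] := pselect (F w !=set0); last first.
    by rewrite (_ : F w = set0)//; apply/seteqP; split => // y Fy; apply: NF; exists y.
  apply: (@sub_countable _ _ _ [set y0]) => //; apply: subset_card_le.
  move=> y [Py [n' [w' e']]]; apply: inj => //; apply/funext => i.
  have nn : n' = n by rewrite -(size_mkseq (D y) n') w' -w0 size_mkseq.
  rewrite nn in w' e'; have [iN|ni] := ltnP i n.
    by rewrite -(nth_mkseq 0%N (D y) iN) w' -w0 nth_mkseq.
  have := congr1 (fun f => f (i - n)%N) (etrans e' (esym e0)).
  by rewrite /tail subnKC.
apply: sub_countable cF; apply: subset_card_le => y [Py [n [e|e]]].
  by exists (mkseq (D y) n, true) => //; split => //; exists n.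
by exists (mkseq (D y) n, false) => //; split => //; exists n.
Qed.

(** The exceptional set [E] consists of the parameters whose code is eventually
    (t1 t2)^oo or its mirror image, where uniqueness may fail. *)
Lemma univoque_measure_gt0 : (0 < hausdorff_measure s (univoque_set N b))%E.
Proof.
have b0 : 0 < b by exact: lt_trans b1.
have r0 : 0 < rho by exact: lt_trans rho1.
have [D HD] := exists_coding t1N ct2 t21 rho1 rho_char middle_digit_exists.
have inj y y' : 0 <= y < rho - 1 -> 0 <= y' < rho - 1 -> D y = D y' -> y = y'.
  move=> yr yr' E; apply/eqP; rewrite -subr_eq0; apply/eqP.
  apply: (expn_le_eq0 rho1) => n; apply: (HD y yr).2 => // i _.
  by rewrite E.
pose per := periodic_seq [:: t1; t2].
pose E := [set y | 0 <= y < rho - 1 /\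
  exists n, tail n (D y) = per \/ tail n (D y) = mirror N per].
pose H := (rho - 1 + (t2 - c)%:R) * rho.
have H0 : 0 < H.
  by rewrite mulr_gt0// ltr_wpDr// subr_gt0.
have bs0 : 0 < b `^ s by exact: powR_gt0.
apply: (@hausdorff_measure_gt0_of_holder _ s _ (rho - 1) (H * (b `^ s) ^+ 3) E
   (fun y => seqval b (D y))) => //.
- by rewrite subr_gt0.
- by rewrite mulr_gt0// exprn_gt0.
- exact: countable_fixed_tails.
- move=> y yr NE; have [I _] := HD y yr; have [Dd _ _] := I.
  apply: code_univoque => //; apply: (inner_unique t1N ct2 t21 b1 bper) => // n e.
    by apply: NE; split => //; exists n; left.
  apply: NE; split => //; exists n; right.
  by rewrite /per -e tail_mirror mirrorK//; exact: tail_digits.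
- move=> y y' yr yr'; have [I Hy] := HD y yr; have [I' _] := HD y' yr'.
  have [EE|NE] := pselect (D y = D y').
    rewrite (inj _ _ yr yr' EE) subrr normr0.
    by rewrite mulr_ge0 ?powR_ge0// mulr_ge0 ?exprn_ge0// ltW.
  have /existsNP[k /eqP neq] : ~ forall k, D y k = D y' k by move=> EE; apply/NE/funext.
  have [n ne nmin] := ex_minnP (ex_intro (fun k => D y k != D y' k) k neq).
  have agree i : (i < n)%N -> D y i = D y' i.
    by move=> iN; apply/eqP; apply: contraLR iN => /nmin; rewrite -leqNgt.
  have sep := inner_separation t1N ct2 t21 b1 bper I I' agree (elimN eqP ne).
  apply: le_trans (Hy y' yr' n agree) _; rewrite -/H -mulrA ler_pM2l//.
  apply: (@le_trans _ _ ((b `^ s) ^- n)).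
    rewrite lef_pV2 ?posrE ?exprn_gt0// lerXn2r// ?nnegrE ltW//.
  have -> : (b `^ s) ^- n = (b `^ s) ^+ 3 * (b ^- n.+3) `^ s.
    rewrite powR_exprVn// -(addn3 n) exprD; field.
    by rewrite !expf_neq0// gt_eqF.
  rewrite ler_pM2l ?exprn_gt0//.
  by apply: ge0_ler_powR; rewrite ?nnegrE ?invr_ge0 ?exprn_ge0 ?(ltW b0).
Qed.

End lower_bound.

(** * The dimension formula *)
Lemma admissible2 N t1 t2 : admissible N [:: t1; t2] ->
  [/\ (t1 < N)%N, (N.-1 - t1 <= t2)%N & (t2 < t1)%N].
Proof.
move=> [_ /and3P[t1N t2N _] /= t2l H]; have [H1 H2] := H 1%N isT.
move: H1 H2; rewrite /block_le /compl_block /incr_last /compl_digit /=.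
rewrite !lexi_cons !leEnat => /andP[h1 _] /andP[h2 _].
by split=> //; lia.
Qed.

Section main.
Context {R : realType}.
Variables (N t1 t2 : nat).
Let c := (N.-1 - t1)%N.
Hypotheses (t1N : (t1 < N)%N) (ct2 : (c <= t2)%N) (t21 : (t2 < t1)%N).

Definition growth_rate : R :=
  (2 * t1%:R + 1 - N%:R + Num.sqrt ((2 * t1%:R + 1 - N%:R) ^+ 2
     + 4 * (2 * t2%:R + 2 - N%:R))) / 2.

Let aE : (t1 - c)%:R = 2 * t1%:R + 1 - N%:R :> R.
Proof.
have : (t1 - c + N = t1 + t1 + 1)%N by rewrite /c; lia.
by move=> /(congr1 (fun n => n%:R : R)); rewrite !natrD; lra.
Qed.

Let eE : (t2 - c)%:R = t1%:R + t2%:R + 1 - N%:R :> R.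
Proof.
have : (t2 - c + N = t1 + t2 + 1)%N by rewrite /c; lia.
by move=> /(congr1 (fun n => n%:R : R)); rewrite !natrD; lra.
Qed.

(** The discriminant is (2 t1 + 1 - N - 2) ^ 2 + 8 (t2 - c); the square root
    being at least this number and its opposite gives the two lower bounds for
    [growth_rate] below. *)
Let sqrt_disc_ge (x : R) : x ^+ 2 = (2 * t1%:R + 1 - N%:R - 2) ^+ 2 ->
  x <= Num.sqrt ((2 * t1%:R + 1 - N%:R) ^+ 2
     + 4 * (2 * t2%:R + 2 - N%:R)).
Proof.
move=> xE; apply: le_trans (ler_norm _) _; rewrite -sqrtr_sqr; apply: ler_wsqrtr.
by rewrite xE; have : 0 <= (t2 - c)%:R :> R by []; rewrite eE; lra.
Qed.

(** The quadratic equation of [growth_rate], in the factored form in which the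
    transition counts appear. *)
Lemma growth_rate_char :
  (growth_rate - 1) * (growth_rate - ((t1 - c)%:R - 1)) = 2 * (t2 - c)%:R.
Proof.
rewrite aE eE /growth_rate; set a := 2 * t1%:R + 1 - N%:R.
set D := a ^+ 2 + _.
have D0 : 0 <= D.
  have : 0 <= (t2 - c)%:R :> R by []; have := sqr_ge0 (a - 2); rewrite eE /D /a; lra.
have := sqr_sqrtr D0; set r := Num.sqrt D => rE.
have -> : ((a + r) / 2 - 1) * ((a + r) / 2 - (a - 1))
    = (r ^+ 2 - (a - 2) ^+ 2) / 4 by field.
by rewrite rE /D /a; field.
Qed.

Lemma growth_rate_ge1 : 1 <= growth_rate.
Proof.
have : 2 - (2 * t1%:R + 1 - N%:R) <= Num.sqrt ((2 * t1%:R + 1 - N%:R) ^+ 2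
     + 4 * (2 * t2%:R + 2 - N%:R)) :> R by apply: sqrt_disc_ge; ring.
by rewrite /growth_rate; lra.
Qed.

Lemma growth_rate_gea : (t1 - c)%:R - 1 <= growth_rate.
Proof.
have : (2 * t1%:R + 1 - N%:R) - 2 <= Num.sqrt ((2 * t1%:R + 1 - N%:R) ^+ 2
     + 4 * (2 * t2%:R + 2 - N%:R)) :> R by exact: sqrt_disc_ge.
by rewrite /growth_rate aE; lra.
Qed.

(** For s on either side of ln rho / ln b, the number b ^ s lies on the
    corresponding side of rho, and the measure bounds apply. *)
Lemma univoque_dim (bL bU b : R) :
  1 < bL -> bL <= b -> b <= bU -> bU <= N%:R ->
  quasi_greedy N bL =1 periodic_seq [:: t1; t2] ->
  quasi_greedy N bU =1 thue_morse N [:: t1; t2.+1] ->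
  hausdorff_dim (univoque_set N b) = (ln growth_rate / ln b)%:E.
Proof.
move=> bL1 bLb bbU bUN qL qU.
have N0 : (0 < N)%N by lia.
have b1 : 1 < b by exact: lt_le_trans bLb.
have b0 : 0 < b by exact: lt_trans b1.
have bN : b <= N%:R by exact: le_trans bUN.
have bL0 : t1%:R * bL + t2%:R + 1 <= bL ^+ 2.
  apply: period_bound => // n.
  by rewrite -(funext qL); exact: quasi_greedy_psum_lt1.
have bper : t1%:R * b + t2%:R + 1 <= b ^+ 2 by exact: (period_bound_mono (bL := bL)).
have r1 := growth_rate_ge1; have ra := growth_rate_gea; have rc := growth_rate_char.
have r0 : 0 < growth_rate by exact: lt_le_trans r1.
have lb0 : 0 < ln b by exact: ln_gt0.
have powE s : b `^ s = expR (s * ln b) by rewrite /powR gt_eqF.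
apply/eqP; rewrite eq_le; apply/andP; split; last first.
  apply: le_ereal_inf_tmp => _ [s /= [s0 Hs] <-].
  rewrite lee_fin leNgt; apply/negP => sl.
  have bs : b `^ s < growth_rate.
    by rewrite powE -(lnK r0) ltr_expR -ltr_pdivlMr.
  have rho1 : 1 < growth_rate.
    by apply: le_lt_trans bs; rewrite powE -expR0 ler_expR mulr_ge0// ltW.
  have := univoque_measure_gt0 t1N ct2 t21 rho1 rc b1 bper s0 (ltW bs).
  by rewrite Hs ltxx.
apply/lee_addgt0Pr => eps e0.
have d0 : 0 <= ln growth_rate / ln b by rewrite divr_ge0 ?ln_ge0// ltW.
rewrite -EFinD; set s := _ + eps.
have s0 : 0 <= s by rewrite addr_ge0// ltW.
apply: ereal_inf_lbound; exists s => //=; split => //.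
have bs : growth_rate < b `^ s.
  by rewrite powE -[X in X < _](lnK r0) ltr_expR -ltr_pdivrMr// ltrDl.
pose tau := (growth_rate + b `^ s) / 2.
have tr : growth_rate < tau by rewrite /tau; lra.
have tb : tau < b `^ s by rewrite /tau; lra.
have tau1 : 1 < tau by exact: le_lt_trans tr.
have taua : (t1 - c)%:R - 1 < tau by exact: le_lt_trans tr.
have tauc : 0 < (tau - 1) * (tau - ((t1 - c)%:R - 1)) - 2 * (t2 - c)%:R.
  rewrite -rc; move: ra r1 tr; set x := (t1 - c)%:R - 1; nra.
have qUE := funext qU.
have [C C0 HC] : exists2 C, 0 <= C & forall n,
    pcover (lex_bounded N (quasi_greedy N bU)) n (C * tau ^+ n).
  rewrite qUE; apply: (pcover_lex_bounded t1N ct2 t21) => // m i im.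
  exact: (@thue_morse_doubling N [:: t1; t2.+1]).
have N2 : (2 <= N)%N by move: t1N t21; clear; lia.
have [K HK] := pcover_codes N2 b1 bN bbU tau1 C0 HC.
exact: (univoque_measure_eq0 b1 bN s0 tau1 tb HK).
Qed.

End main.

Theorem theorem7p2 (R : realType) (N : nat) (hN : (2 <= N)%N) (t1 t2 : nat)
  (betaL betaU : R)
  (hI : admissible_interval N [:: t1; t2] betaL betaU) :
  [/\ Num.ceil ((N%:R - 1) / 2 : R) <= t1%:Z /\ (t1 <= N - 1)%N,
      (compl_digit N t1 <= t2 < t1)%N &
      forall beta : R, betaL <= beta <= betaU ->
        hausdorff_dim (univoque_set N beta) =
        ((ln (2 * t1%:R + 1 - N%:R
              + Num.sqrt ((2 * t1%:R + 1 - N%:R) ^+ 2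
                          + 4 * (2 * t2%:R + 2 - N%:R))) - ln 2)
         / ln beta)%:E].
Proof.
have [adm /andP[bL1 _] /andP[_ bUN] qL qU] := hI.
have [t1N ct2 t21] := admissible2 adm.
split.
- split; last lia.
  have : (N <= t1 + t1 + 1)%N by lia.
  by rewrite ceil_le_int ler_pdivrMr// -(ler_nat R) !natrD; lra.
- by rewrite /compl_digit ct2.
move=> b /andP[bLb bbU].
rewrite (univoque_dim t1N ct2 t21 bL1 bLb bbU bUN qL qU).
have := growth_rate_ge1 (R := R) t1N ct2 t21.
rewrite /growth_rate ler_pdivlMr// mul1r => X2.
by rewrite ln_div// posrE// (lt_le_trans _ X2).
Qed.
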